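(* Let $k \ge 1$ be an integer. For $\mathbf{x} \in \mathbb{R}^k$ and $T>1$, let $N(\mathbf{x},T)$ denote the number of $(n,\mathbf{p}) \in \mathbb{Z}\times\mathbb{Z}^k$ with $1 \le |n| < T$ satisfying $$\|n\mathbf{x} - \mathbf{p}\| \le \frac{1}{|n|^{1/k}}.$$ Then for Lebesgue-almost every $\mathbf{x} \in \mathbb{R}^k$, $$\lim_{T\to\infty} \frac{N(\mathbf{x},T)}{2B_k \log T} = 1.$$
   Context: $\|\cdot\|$ denotes the Euclidean norm and $B_k$ denotes the volume of the Euclidean unit ball in $\mathbb{R}^k$. *)

(* Defs.v *)
From HB Require Import structures.
From mathcomp Require Import all_boot all_order all_algebra finmap.
From mathcomp Require Import all_classical all_reals all_analysis.
From mathcomp Require Import measurable_realfun zify.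
Set Implicit Arguments.
Unset Strict Implicit.
Unset Printing Implicit Defensive.
Import Order.TTheory GRing.Theory Num.Theory.
Import numFieldNormedType.Exports.

Local Open Scope classical_set_scope.
Local Open Scope ring_scope.

Section cons_measure.
Context d (T : measurableType d) (R : realType) (n : nat).
Variable mu : {sigma_finite_measure set T -> \bar R}.
Variable nu : {sigma_finite_measure set (n.-tuple T) -> \bar R}.

Definition cons_pair (z : T * n.-tuple T) : n.+1.-tuple T :=
  [the n.+1.-tuple T of z.1 :: z.2].

Lemma measurable_cons_pair : measurable_fun [set: T * n.-tuple T] cons_pair.
Proof. exact: measurable_cons. Qed.

Definition cons_measure : set (n.+1.-tuple T) -> \bar R :=
  pushforward (mu \x nu)%E cons_pair.

Let cons_measure0 : cons_measure set0 = 0%E.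
Proof. by rewrite /cons_measure /pushforward preimage_set0 measure0. Qed.

Let cons_measure_ge0 A : (0 <= cons_measure A)%E.
Proof. exact: (measure_ge0 (mu \x nu)%E). Qed.

Let cons_measure_sigma_additive : semi_sigma_additive cons_measure.
Proof.
move=> F mF tF mUF; rewrite /cons_measure /pushforward preimage_bigcup.
apply: (@measure_semi_sigma_additive _ _ _ (mu \x nu)%E).
- by move=> i; rewrite -[X in measurable X]setTI; exact: measurable_cons_pair.
- apply/trivIsetP => /= i j _ _ ij; rewrite -preimage_setI.
  by move/trivIsetP : tF => /(_ _ _ _ _ ij) ->//; rewrite preimage_set0.
- rewrite -preimage_bigcup -[X in measurable X]setTI.
  exact: measurable_cons_pair.
Qed.

HB.instance Definition _ := isMeasure.Build _ _ _ cons_measure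
  cons_measure0 cons_measure_ge0 cons_measure_sigma_additive.

Lemma cons_measureE (A : set T) (B : set (n.-tuple T)) :
  measurable A -> measurable B ->
  cons_measure [set x | A (thead x) /\ B [tuple of behead x]] = (mu A * nu B)%E.
Proof.
move=> mA mB; rewrite -product_measure1E//; congr ((mu \x nu)%E _).
apply/seteqP; split=> [[a b]|[a b]] [/= Aa Bb]; split => //=;
  move: Bb; rewrite (_ : [tuple of _] = b)//; exact: val_inj.
Qed.

Lemma measurable_cons_rect (A : set T) (B : set (n.-tuple T)) :
  measurable A -> measurable B ->
  measurable [set x : n.+1.-tuple T | A (thead x) /\ B [tuple of behead x]].
Proof.
move=> mA mB; apply: (@measurableI _ _ [set x | A (thead x)]).
  by rewrite -[X in measurable X]setTI; exact: measurable_tnth.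
by rewrite -[X in measurable X]setTI; exact: measurable_behead.
Qed.

Let cons_measure_sigma_finite : sigma_finite setT cons_measure.
Proof.
have /sigma_finiteP[F [TF ndF Foo]] := sigma_finiteT mu.
have /sigma_finiteP[G [TG ndG Goo]] := sigma_finiteT nu.
exists (fun i => [set x | F i (thead x) /\ G i [tuple of behead x]]).
  apply/seteqP; split=> // x _.
  have [i _ Fi] : (\bigcup_i F i) (thead x) by rewrite -TF.
  have [j _ Gj] : (\bigcup_i G i) [tuple of behead x] by rewrite -TG.
  exists (maxn i j) => //; split.
  - by move: Fi; exact/subsetPset/ndF/leq_maxl.
  - by move: Gj; exact/subsetPset/ndG/leq_maxr.
move=> k; have [mF Fk] := Foo k; have [mG Gk] := Goo k.
split; first exact: measurable_cons_rect.
by rewrite cons_measureE// lte_mul_pinfty// ge0_fin_numE.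
Qed.

HB.instance Definition _ := Measure_isSigmaFinite.Build _ _ _ cons_measure
  cons_measure_sigma_finite.

End cons_measure.

Section power_measure.
Context d (T : measurableType d) (R : realType).
Variable mu : {sigma_finite_measure set T -> \bar R}.

(* The k-fold product measure mu \x ... \x mu, transported to k-tuples. *)
Fixpoint power_measure (k : nat) :
    {sigma_finite_measure set (k.-tuple T) -> \bar R} :=
  match k with
  | 0 => \d_([tuple] : 0.-tuple T)
  | k'.+1 => cons_measure mu (power_measure k')
  end.

Lemma power_measure_rect (k : nat) (A : 'I_k -> set T) :
  (forall i, measurable (A i)) ->
  power_measure k [set x | forall i, A i (tnth x i)] = (\prod_(i < k) mu (A i))%E.
Proof.
elim: k A => [A _|k IH A mA] /=.
  by rewrite big_ord0 diracE mem_set//= => -[].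
rewrite big_ord_recl -IH//.
rewrite (_ : [set x | _] = [set x : k.+1.-tuple T | A ord0 (thead x) /\
   [set y : k.-tuple T | forall i, A (lift ord0 i) (tnth y i)]
      [tuple of behead x]]).
  apply: cons_measureE => //.
  rewrite (_ : [set x | _] = \bigcap_(i in [set: 'I_k])
    (fun y : k.-tuple T => tnth y i) @^-1` A (lift ord0 i)).
    apply: fin_bigcap_measurable => // i _.
    by rewrite -[X in measurable X]setTI; exact: measurable_tnth.
  by apply/seteqP; split=> y /= Ay i => [_|]; exact: Ay.
apply/seteqP; split=> x /=.
  move=> Ax; split; first exact: Ax.
  by move=> i; move: (Ax (lift ord0 i)); rewrite [in X in X -> _](tuple_eta x) tnthS.
move=> [A0 AS] i; have [j ->|->//] := unliftP ord0 i.
by rewrite (tuple_eta x) tnthS.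
Qed.

End power_measure.

Definition lebesgue_Rn (R : realType) (k : nat) :
    {sigma_finite_measure set (k.-tuple (measurableTypeR R)) -> \bar R} :=
  power_measure (@lebesgue_measure R) k.

(* The library norm on row vectors is the sup norm. *)
Definition enorm (R : realType) (k : nat) (v : 'I_k -> R) : R :=
  Num.sqrt (\sum_(i < k) v i ^+ 2).

Lemma coord_le_enorm (R : realType) (k : nat) (v : 'I_k -> R) (i : 'I_k) :
  `|v i| <= enorm v.
Proof.
rewrite /enorm -sqrtr_sqr ler_wsqrtr// (bigD1 i)//= lerDl.
by apply: sumr_ge0 => j _; exact: sqr_ge0.
Qed.

Definition unit_ball (R : realType) (k : nat) :
    set (k.-tuple (measurableTypeR R)) :=
  [set x | enorm (tnth x) <= 1].
Arguments unit_ball : clear implicits.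

Lemma measurable_unit_ball (R : realType) (k : nat) :
  measurable (unit_ball R k).
Proof.
rewrite (_ : unit_ball R k =
    (fun x : k.-tuple (measurableTypeR R) => \sum_(i < k) (tnth x i : R) ^+ 2)
      @^-1` `]-oo, 1]).
  rewrite -[X in measurable X]setTI; apply: (_ : measurable_fun setT _) => //.
  apply: measurable_sum => i; apply: measurable_funX.
  exact: measurable_tnth.
apply/seteqP; split=> x; rewrite /unit_ball /enorm /= in_itv/= => x1.
  by rewrite -(@ler_sqrt _ _ 1)// sqrtr1.
by rewrite -[leRHS]sqrtr1 ler_sqrt.
Qed.

Lemma lebesgue_unit_ball_fin_num (R : realType) (k : nat) :
  lebesgue_Rn R k (unit_ball R k) \is a fin_num.
Proof.
have mI (i : 'I_k) : measurable (`[-1, 1]%classic : set (measurableTypeR R)) by [].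
have mC : measurable [set x : k.-tuple (measurableTypeR R) |
    forall i, `[-1, 1]%classic (tnth x i)].
  rewrite (_ : [set x | _] = \bigcap_(i in [set: 'I_k])
    (fun y : k.-tuple (measurableTypeR R) => tnth y i) @^-1` `[-1, 1]%classic).
    apply: fin_bigcap_measurable => // i _.
    by rewrite -[X in measurable X]setTI; exact: measurable_tnth.
  by apply/seteqP; split=> y /= Ay i => [_|]; exact: Ay.
rewrite ge0_fin_numE//; apply: (@le_lt_trans _ _ (lebesgue_Rn R k
    [set x | forall i, `[-1, 1]%classic (tnth x i)])).
  apply: le_measure; rewrite ?inE//; first exact: measurable_unit_ball.
  move=> x /= x1 i; rewrite in_itv/= -ler_norml.
  exact: le_trans (coord_le_enorm _ _) x1.
rewrite [ltLHS](power_measure_rect _ mI).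
rewrite (eq_bigr (fun=> (2 : R)%:E)); last first.
  move=> i _; rewrite [LHS](lebesgue_measure_itv `[-1, 1]%R)/= lte_fin gtrN//.
  by rewrite -EFinD opprK.
by rewrite prodEFin ltry.
Qed.

Definition ball_volume (R : realType) (k : nat) : R :=
  fine (lebesgue_Rn R k (unit_ball R k)).

Definition approximations (R : realType) (k : nat)
    (x : k.-tuple (measurableTypeR R)) (T : R) : set (int * k.-tuple int) :=
  [set np | [/\ 1 <= `|np.1|, (`|np.1|%:~R : R) < T &
     enorm (fun i => np.1%:~R * (tnth x i : R) - (tnth np.2 i)%:~R)
       <= 1 / (`|np.1|%:~R `^ (1 / k%:R)) ] ].

Lemma finite_approximations (R : realType) (k : nat)
    (x : k.-tuple (measurableTypeR R)) (T : R) :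
  finite_set (approximations x T).
Proof.
pose B : R := T * (1 + \sum_(i < k) `|tnth x i : R|) + 1.
pose M := (Num.trunc B).+1.
have BM : B < M%:R by rewrite /M truncnS_gt.
pose f (u : 'I_(M.*2.+1) * k.-tuple 'I_(M.*2.+1)) : int * k.-tuple int :=
  ((u.1 : nat)%:Z - M%:Z, [tuple of map (fun j : 'I__ => (j : nat)%:Z - M%:Z) u.2]).
have key (m : int) : (`|m|%:~R : R) <= B ->
    exists j : 'I_(M.*2.+1), (j : nat)%:Z - M%:Z = m.
  move=> mB; have mM : `|m| < M%:Z by rewrite -(ltr_int R) (le_lt_trans mB).
  have jlt : (`|(m + M%:Z)%R|%N < M.*2.+1)%N by lia.
  exists (Ordinal jlt) => /=; lia.
apply: (@sub_finite_set _ _ (f @` setT)); last exact: finite_image.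
case=> n p [/= n1 nT np].
have n1R : 1 <= (`|n|%:~R : R) by rewrite -(ler_int R) in n1.
have T0 : 0 <= T by apply: le_trans (ltW nT); exact: le_trans n1R.
have S0 : 0 <= \sum_(i < k) `|tnth x i : R| by apply: sumr_ge0.
have pB i : (`|tnth p i|%:~R : R) <= B.
  have h1 : `|n%:~R * (tnth x i : R) - (tnth p i)%:~R| <= 1.
    apply: le_trans (coord_le_enorm
      (fun i => n%:~R * (tnth x i : R) - (tnth p i)%:~R) i) _.
    apply: le_trans np _; rewrite div1r invf_le1 ?powR_gt0//; last first.
      exact: lt_le_trans n1R.
    have -> : (1 <= (`|n|%:~R : R) `^ (1 / k%:R)) =
        (1 `^ (1 / k%:R) <= (`|n|%:~R : R) `^ (1 / k%:R)) by rewrite powR1.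
    apply: ge0_ler_powR; rewrite ?nnegrE ?divr_ge0//; exact: le_trans n1R.
  rewrite intr_norm.
  have -> : (tnth p i)%:~R = n%:~R * (tnth x i : R)
     - (n%:~R * (tnth x i : R) - (tnth p i)%:~R) by rewrite subKr.
  apply: le_trans (ler_normB _ _) _; rewrite lerD// normrM ler_pM//.
    by rewrite -intr_norm ltW.
  rewrite (bigD1 i)//= addrCA lerDl addr_ge0//; exact: sumr_ge0.
have nB : (`|n|%:~R : R) <= B.
  apply: le_trans (ltW nT) _; rewrite /B mulrDr mulr1 -addrA lerDl.
  by rewrite addr_ge0// mulr_ge0.
have [j jn] := key _ nB.
pose q i := projT1 (cid (key _ (pB i))).
exists (j, [tuple q i | i < k]) => //; rewrite /f /= jn; congr pair.
apply: eq_from_tnth => i; rewrite tnth_map tnth_mktuple.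
exact: (projT2 (cid (key _ (pB i)))).
Qed.

Definition nb_approximations (R : realType) (k : nat)
    (x : k.-tuple (measurableTypeR R)) (T : R) : nat :=
  #|` fset_set (approximations x T)|.

(* Main.v *)
Require Import Defs.
From HB Require Import structures.
From mathcomp Require Import all_boot all_order all_algebra finmap.
From mathcomp Require Import all_classical all_reals all_analysis.
From mathcomp Require Import measurable_realfun zify ring lra.
Set Implicit Arguments.
Unset Strict Implicit.
Unset Printing Implicit Defensive.
Import Order.TTheory GRing.Theory Num.Theory.
Import numFieldNormedType.Exports.
Local Open Scope classical_set_scope.
Local Open Scope ring_scope.

(** Put r_n = n^(-1/k).  Solutions with n < 0 are the opposites of solutions with
n > 0, so the count is twice the number of (n, p) with 1 <= n < T for which the
normalized defect (n x - p) / r_n lies in the unit ball.  For fixed n such x have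
density B_k r_n^k = B_k / n, hence about B_k log T solutions are expected; what has
to be proved is that the count concentrates around its mean.

The concentration is proved by a second moment computation, for boxes which are
products of intervals [a_i, b_i) with a_i <= 0 <= b_i instead of the ball.  The
measure of the intersection of two boxes centred near p/n and q/m is then a
product over the coordinates.  In one coordinate the overlap depends only on
c = (p m - q n) / gcd(n, m).  As the intervals contain 0, the number of admissible
nonzero values of c is at most length divided by spacing, with no additional error
term (cross_count); hence pairs with p m <> q n are no more correlated than
independent events (overlap_sum_distinct).  In k coordinates, pairs of fractions
which agree in some coordinates but not in all contribute only O(log T)
(distinct_sum_le, gcd_sum_le).

There remain the pairs with p/n = q/m.  For k = 1 they contribute (log T)^2, which
is as large as the square of the mean: a very good approximation a/b makes many of
its multiples da/db good.  So the count is first restricted to the (n, p) whose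
greatest common divisor is at most K.  Equal fractions then contribute
O(K log T) to the second moment (same_sum_le), and the discarded part has mean
O((log T) / K) (bad_mean_le).  With log T close to j^4 and K close to j^2 the
relative errors are both O(1 / j^2).  They are summable, so that the normalized
counts converge almost everywhere along this sequence (ae_cvg0_of_summable); as
the counts increase with T and the values j^4 and (j+1)^4 are asymptotically
equivalent, they converge along all T (cvg_of_sparse, ae_hits_cvg).

Inclusion-exclusion over corners passes from boxes containing 0 to all cells
of a grid of mesh 1/M (ae_cells_cvg).  The ball lies between a union of such cells
and a larger one, with O(M^(k-1)) cells more (outer_inner_card), whence the
result for the ball (ae_ball_cvg).

Throughout, x is confined to a cube [-L, L]^k and p to the vectors with
-(L n - 2) <= p_i < L n - 2.  The corresponding boxes lie inside the cube, and for
x well inside the cube only finitely many solutions are lost. *)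

(** * Overlaps of intervals around two rational grids *)

(** Such indices lie in different blocks of length g, and t blocks cover the range. *)
Lemma count_class (len t g : nat) (P : pred 'I_len) : (0 < g)%N ->
  (len <= t * g)%N ->
  (forall i j : 'I_len, P i -> P j -> i = j %[mod g]) -> (#|P| <= t)%N.
Proof.
move=> g0 lentg Pmod.
have lt_t (i : 'I_len) : (i %/ g < t)%N.
  by rewrite ltn_divLR//; exact: leq_trans (ltn_ord i) lentg.
rewrite -[leqRHS]card_ord; pose f i := Ordinal (lt_t i).
rewrite -(@card_in_image _ _ f P) ?max_card// => i j Pi Pj [ij].
by apply: val_inj; rewrite /= (divn_eq i g) (divn_eq j g) ij (Pmod i j).
Qed.

(** Numerators for the denominator n, indexed by i < 2 (L n - 2): they fill the
interval from - (L n - 2) to L n - 3.  The margin 2 keeps the boxes below inside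
[-L, L]^k, because their sides have endpoints in [-2, 2] before rescaling. *)
Definition numer (L n i : nat) : int := i%:Z - (L * n - 2)%:Z.

(** The numerator of p/n - q/m over the common denominator n m. *)
Definition cross (L n m i j : nat) : int :=
  numer L n i * m%:Z - numer L m j * n%:Z.

(** A solution (p, q) of p m - q n = z is determined by p, and p is determined
modulo n / gcd n m. *)
Lemma cross_fiber (L n m : nat) (z : int) : (0 < n)%N -> (0 < m)%N ->
  (#|[pred ij : 'I_(2 * (L * n - 2)) * 'I_(2 * (L * m - 2)) |
      cross L n m ij.1 ij.2 == z]| <= 2 * L * gcdn n m)%N.
Proof.
move=> n0 m0; set S := [pred _ | _].
have d0 : (0 < gcdn n m)%N by rewrite gcdn_gt0 n0.
set d := gcdn n m in d0 *.
have [n' nE] : exists n', n = (n' * d)%N.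
  by exists (n %/ d)%N; rewrite divnK// dvdn_gcdl.
have [m' mE] : exists m', m = (m' * d)%N.
  by exists (m %/ d)%N; rewrite divnK// dvdn_gcdr.
have nZ : n%:Z = n'%:Z * d%:Z by rewrite [in LHS]nE PoszM.
have mZ : m%:Z = m'%:Z * d%:Z by rewrite [in LHS]mE PoszM.
have cop : coprime n' m'.
  have : gcdn (n' * d) (m' * d) = d by rewrite -nE -mE.
  by rewrite -muln_gcdl /coprime => /eqP; rewrite -[X in _ == X]mul1n eqn_pmul2r.
have n'0 : (0 < n')%N by move: n0; rewrite nE muln_gt0 => /andP[].
(* z and the first index determine the second one *)
rewrite -(@card_in_image _ _ (fun ij => ij.1) S); last first.
  move=> [i j] [i' j']; rewrite !inE/= /cross /numer => /eqP zij /eqP zij' ii'.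
  subst i'; congr pair; apply: val_inj => /=.
  have : (j%:Z - j'%:Z) * n%:Z = 0 by move: zij zij'; lia.
  by move/eqP; rewrite mulf_eq0 subr_eq0 => /orP[|]; lia.
(* the first indices in a fibre agree modulo n' = n / d *)
apply: (@count_class _ _ n') => //.
  by rewrite -mulnA (mulnC (gcdn _ _)) -/d -nE -mulnA leq_mul2l leq_subr orbT.
move=> x x' /fintype.imageP[[i j] Sij ->{x}] /fintype.imageP[[i' j'] Sij' ->{x'}].
move: Sij Sij'; rewrite !inE/=.
rewrite /cross /numer => /eqP zij /eqP zij'.
have E : (i%:Z - i'%:Z) * m'%:Z = (j%:Z - j'%:Z) * n'%:Z.
  have : ((i%:Z - i'%:Z) * m'%:Z - (j%:Z - j'%:Z) * n'%:Z) * d%:Z = 0.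
    have : (i%:Z - i'%:Z) * m%:Z - (j%:Z - j'%:Z) * n%:Z = 0.
      by move: zij zij'; rewrite !mulrBl; lia.
    by rewrite nZ mZ => {}E; rewrite mulrBl -!mulrA.
  by move/eqP; rewrite mulf_eq0 subr_eq0 => /orP[/eqP//|]; lia.
have : (n'%:Z %| (i%:Z - i'%:Z))%Z.
  by rewrite -(@Gauss_dvdzl _ _ m'%:Z) ?E ?dvdz_mull//.
by rewrite -eqz_mod_dvd => /eqP; rewrite !modz_nat => -[].
Qed.

Definition overlap (R : realType) (s t s' t' : R) : R :=
  Num.max 0 (Num.min t t' - Num.max s s').

Lemma lebesgue_itvI (R : realType) (s t s' t' : R) :
  lebesgue_measure (`[s, t[ `&` `[s', t'[) = (overlap s t s' t')%:E.
Proof.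
rewrite (_ : _ `&` _ = `[Num.max s s', Num.min t t'[%classic); last first.
  apply/seteqP; split=> x /=; rewrite !in_itv/= ge_max lt_min.
    by move=> [/andP[-> ->] /andP[-> ->]].
  by move=> /andP[/andP[-> ->] /andP[-> ->]].
rewrite lebesgue_measure_itv/= lte_fin /overlap.
move: (Num.max s s') (Num.min t t') => x y.
have [xy|yx] := ltrP x y; first by rewrite -EFinD max_r// subr_ge0 ltW.
by rewrite max_l// subr_le0.
Qed.

Lemma overlap_shift (R : realType) (c s t s' t' : R) :
  overlap (s + c) (t + c) (s' + c) (t' + c) = overlap s t s' t'.
Proof. by rewrite /overlap -addr_minl -addr_maxl opprD addrACA subrr addr0. Qed.

Lemma overlap_ge0 (R : realType) (s t s' t' : R) : 0 <= overlap s t s' t'.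
Proof. by rewrite /overlap le_max lexx. Qed.

Lemma overlap_le (R : realType) (s t s' t' : R) : s <= t ->
  overlap s t s' t' <= t - s.
Proof.
move=> st; rewrite /overlap ge_max subr_ge0 st/=.
by rewrite lerB// ?ge_min ?le_max lexx.
Qed.

Lemma overlap_id (R : realType) (s t : R) : s <= t -> overlap s t s t = t - s.
Proof. by move=> st; rewrite /overlap minxx maxxx max_r// subr_ge0. Qed.

Lemma cross_dvd L n m i j : ((gcdn n m)%:Z %| cross L n m i j)%Z.
Proof. by rewrite rpredB// dvdz_mull// dvdzE/= ?dvdn_gcdl ?dvdn_gcdr. Qed.

(** As 0 lies in [s, t], the number of nonzero multiples of d = gcd n m in this
interval is at most (t - s) / d without any rounding error, and each of them is
taken at most 2 L d times. *)
Lemma cross_count (R : realType) (L n m : nat) (s t : R) :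
  (0 < n)%N -> (0 < m)%N -> s <= 0 -> 0 <= t ->
  \sum_(i < 2 * (L * n - 2)) \sum_(j < 2 * (L * m - 2))
     ((cross L n m i j != 0) && (s <= (cross L n m i j)%:~R < t))%:R
  <= (2 * L)%:R * (t - s).
Proof.
move=> n0 m0 s0 t0; set d := gcdn n m.
have d0 : (0 < d)%N by rewrite gcdn_gt0 n0.
have dR0 : 0 < d%:R :> R by rewrite ltr0n.
(* u negative and v positive multiples of d are admissible *)
pose u := Num.truncn (- s / d%:R); pose v := Num.truncn (t / d%:R).
have uE : u%:R <= - s / d%:R by rewrite truncn_le// divr_ge0// oppr_ge0.
have vE : v%:R <= t / d%:R by rewrite truncn_le// divr_ge0.
pose C := [seq - (c.+1%:Z * d%:Z) | c <- iota 0 u] ++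
          [seq c.+1%:Z * d%:Z | c <- iota 0 v].
have sC : size C = (u + v)%N by rewrite size_cat !size_map !size_iota.
have inC (z : int) : (d%:Z %| z)%Z -> z != 0 -> s <= z%:~R < t -> z \in C.
  move=> /dvdzP[c ->]; rewrite mulf_eq0 negb_or => /andP[c0 _] /andP[sz zt].
  rewrite mem_cat; apply/orP; case: (ltrP c 0) => hc; [left|right].
    apply/mapP; exists (`|c|.-1)%N; last by rewrite prednK; lia.
    rewrite mem_iota/= add0n prednK; last by lia.
    rewrite truncn_ge_nat ?divr_ge0 ?oppr_ge0// ler_pdivlMr//.
    rewrite lerNr; apply: le_trans sz _; rewrite rmorphM/= -mulNr.
    by rewrite ler_pM2r// pmulrn -rmorphN/= ler_int; lia.
  apply/mapP; exists (`|c|.-1)%N; last by rewrite prednK; lia.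
  rewrite mem_iota/= add0n prednK; last by lia.
  rewrite truncn_ge_nat ?divr_ge0// ler_pdivlMr//.
  apply: le_trans (ltW zt); rewrite rmorphM/=.
  by rewrite ler_pM2r// pmulrn ler_int; lia.
rewrite pair_big/=.
apply: (@le_trans _ _ (\sum_(z <- C) \sum_(ij : 'I_(2 * (L * n - 2)) *
   'I_(2 * (L * m - 2))) (cross L n m ij.1 ij.2 == z)%:R)).
  rewrite exchange_big/=; apply: ler_sum => ij _.
  have [/andP[z0 zst]|_] := boolP (_ && _); last by apply: sumr_ge0.
  have zC := inC _ (cross_dvd L n m ij.1 ij.2) z0 zst.
  by rewrite (big_rem _ zC)/= eqxx lerDl sumr_ge0.
apply: (@le_trans _ _ (\sum_(z <- C) (2 * L * d)%:R)).
  apply: ler_sum => z _; rewrite -natr_sum ler_nat.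
  rewrite -big_mkcond/= sum1_card.
  exact: cross_fiber.
rewrite big_const_seq count_predT iter_addr addr0 sC -[_ *+ (u + v)]mulr_natr.
rewrite (natrM _ (2 * L) d) -mulrA ler_wpM2l// mulrC natrD -ler_pdivlMr//.
by rewrite mulrBl addrC lerD// -mulNr.
Qed.

Lemma cross_count0 (R : realType) (L n m : nat) :
  (0 < n)%N -> (0 < m)%N ->
  \sum_(i < 2 * (L * n - 2)) \sum_(j < 2 * (L * m - 2))
     ((cross L n m i j == 0)%:R : R) <= (2 * L * gcdn n m)%:R.
Proof.
move=> n0 m0; rewrite pair_big/= -natr_sum ler_nat.
rewrite -big_mkcond/= sum1_card.
exact: cross_fiber.
Qed.

(** The condition a <= (n x - p) / u < b on x describes the interval with
endpoints (p + a u) / n and (p + b u) / n. *)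
Definition endpoint (R : realType) (L n i : nat) (a u : R) : R :=
  ((numer L n i)%:~R + a * u) / n%:R.

Definition overlap_at (R : realType) (L n m i j : nat) (a b u v : R) : R :=
  overlap (endpoint L n i a u) (endpoint L n i b u)
          (endpoint L m j a v) (endpoint L m j b v).

(** Translating by p/n leaves only the difference p/n - q/m. *)
Lemma overlap_atE (R : realType) (L n m i j : nat) (a b u v : R) :
  (0 < n)%N -> (0 < m)%N ->
  overlap_at L n m i j a b u v =
  overlap (a * u / n%:R) (b * u / n%:R)
    (a * v / m%:R - (cross L n m i j)%:~R / (n%:R * m%:R))
    (b * v / m%:R - (cross L n m i j)%:~R / (n%:R * m%:R)).
Proof.
move=> n0 m0; set p : R := (numer L n i)%:~R; set q : R := (numer L m j)%:~R.
have nR : n%:R != 0 :> R by rewrite pnatr_eq0 -lt0n.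
have mR : m%:R != 0 :> R by rewrite pnatr_eq0 -lt0n.
have -> : (cross L n m i j)%:~R = p * m%:R - q * n%:R :> R.
  by rewrite /cross rmorphB/= !rmorphM/=.
rewrite -(overlap_shift (p / n%:R)) /overlap_at /endpoint -/p -/q.
by congr overlap; field; rewrite ?nR ?mR.
Qed.

(** Each overlap is the integral over U, the interval of n centred at 0, of the
indicator of a translate of the interval of m.  After exchanging sum and integral,
cross_count bounds the integrand at every point, since U is contained in the
interval of m centred at 0.  The bound is the value expected for independent
events. *)
Lemma overlap_sum_distinct (R : realType) (L n m : nat) (a b u v : R) :
  (0 < n)%N -> (0 < m)%N -> a <= 0 -> 0 <= b -> 0 <= u -> 0 <= v ->
  u / n%:R <= v / m%:R ->
  \sum_(i < 2 * (L * n - 2)) \sum_(j < 2 * (L * m - 2))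
     (cross L n m i j != 0)%:R * overlap_at L n m i j a b u v
  <= (2 * L)%:R * (b - a) ^+ 2 * u * v.
Proof.
move=> n0 m0 a0 b0 u0 v0 uv.
have nR : 0 < n%:R :> R by rewrite ltr0n.
have mR : 0 < m%:R :> R by rewrite ltr0n.
set U := (`[a * u / n%:R, b * u / n%:R[%classic : set (measurableTypeR R)).
have ab : a * u / n%:R <= b * u / n%:R.
  by rewrite -!mulrA ler_wpM2r ?divr_ge0//; exact: le_trans b0.
have lamU : lebesgue_measure U = ((b - a) * u / n%:R)%:E.
  rewrite -(setIid U) lebesgue_itvI overlap_id//; congr EFin; ring.
pose V i j := (`[a * v / m%:R - (cross L n m i j)%:~R / (n%:R * m%:R),
  b * v / m%:R - (cross L n m i j)%:~R / (n%:R * m%:R)[%classic :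
    set (measurableTypeR R)).
have mU : measurable U by exact: measurable_itv.
have mV i j : measurable (V i j) by exact: measurable_itv.
pose f i j y : R := (cross L n m i j != 0)%:R * \1_(V i j) y.
have f0 i j y : 0 <= f i j y by rewrite mulr_ge0.
have mf i j : measurable_fun U (f i j).
  by apply: measurable_funM => //; apply: measurable_indic; exact: mV.
have fE i j : ((cross L n m i j != 0)%:R * overlap_at L n m i j a b u v)%:E =
   (\int[lebesgue_measure]_(y in U) (f i j y)%:E)%E.
  under eq_integral do rewrite EFinM.
  rewrite ge0_integralZl//; last first.
    by apply/measurable_EFinP; apply: measurable_indic; exact: mV.
  rewrite integral_indic// setIC EFinM; congr (_ * _)%E.
  by rewrite overlap_atE// -lebesgue_itvI.
rewrite -lee_fin -sumEFin.
under eq_bigr => i _ do (rewrite -sumEFin; under eq_bigr => j _ do rewrite fE).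
under eq_bigr => i _.
  rewrite -ge0_integral_sum//; last 2 first.
  - by move=> j; apply/measurable_EFinP.
  - by move=> j y _; rewrite lee_fin.
  over.
rewrite -ge0_integral_sum//; last 2 first.
- by move=> i; apply: emeasurable_sum => j; apply/measurable_EFinP.
- by move=> i y _; apply: sume_ge0 => j _; rewrite lee_fin.
have -> : ((2 * L)%:R * (b - a) ^+ 2 * u * v)%:E =
    (((2 * L)%:R * (n%:R * (b - a) * v))%:E * lebesgue_measure U)%E.
  by rewrite lamU -EFinM; congr EFin; field; rewrite gt_eqF.
rewrite -integral_cst//; apply: ge0_le_integral => //.
- by move=> y _; apply: sume_ge0 => i _; apply: sume_ge0 => j _; rewrite lee_fin.
- by apply: emeasurable_sum => i; apply: emeasurable_sum => j; apply/measurable_EFinP.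
move=> y; rewrite /U/= in_itv/= => /andP[ay yb].
under eq_bigr do rewrite sumEFin.
rewrite sumEFin lee_fin.
(* y + c / (n m) lies in the interval of m iff c lies in [s, t) *)
pose s := n%:R * m%:R * (a * v / m%:R - y).
pose t := n%:R * m%:R * (b * v / m%:R - y).
have -> : n%:R * (b - a) * v = t - s by rewrite /s /t; field; rewrite gt_eqF.
apply: le_trans (@cross_count R L n m s t n0 m0 _ _); last 2 first.
- rewrite /s mulr_ge0_le0 ?mulr_ge0// subr_le0; apply: le_trans ay.
  by rewrite -!mulrA ler_wnM2l.
- rewrite /t !mulr_ge0// subr_ge0; apply: le_trans (ltW yb) _.
  by rewrite -!mulrA ler_wpM2l.
apply: ler_sum => i _; apply: ler_sum => j _; rewrite /f indicE.
have [yV|_] := boolP (y \in V i j); last by rewrite mulr0.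
suff -> : s <= (cross L n m i j)%:~R < t by rewrite andbT mulr1.
move: yV; rewrite inE /V/= in_itv/= => /andP[h1 h2].
have nm0 : 0 < n%:R * m%:R :> R by rewrite mulr_gt0.
rewrite /s /t mulrC -ler_pdivlMr// mulrC -ltr_pdivrMl//.
by rewrite [_^-1 * _]mulrC; apply/andP; split; lra.
Qed.

(** For equal fractions the overlap is the whole shorter interval, and there are at
most 2 L gcd n m such pairs. *)
Lemma overlap_sum_same (R : realType) (L n m : nat) (a b u v : R) :
  (0 < n)%N -> (0 < m)%N -> a <= b -> 0 <= u ->
  \sum_(i < 2 * (L * n - 2)) \sum_(j < 2 * (L * m - 2))
     (cross L n m i j == 0)%:R * overlap_at L n m i j a b u v
  <= (2 * L)%:R * (b - a) * u * ((gcdn n m)%:R / n%:R).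
Proof.
move=> n0 m0 ab u0.
have nR : 0 < n%:R :> R by rewrite ltr0n.
apply: (@le_trans _ _ ((2 * L * gcdn n m)%:R * ((b - a) * u / n%:R))).
  apply: le_trans (ler_wpM2r _ (@cross_count0 R L n m n0 m0)); last first.
    by rewrite divr_ge0// mulr_ge0// subr_ge0.
  rewrite mulr_suml; apply: ler_sum => i _; rewrite mulr_suml.
  apply: ler_sum => j _; apply: ler_wpM2l => //.
  rewrite overlap_atE//; apply: le_trans (overlap_le _ _ _) _.
    by rewrite -!mulrA ler_wpM2r// divr_ge0.
  by rewrite -mulrBl -mulrBl.
by rewrite natrM le_eqVlt; apply/orP; left; apply/eqP; ring.
Qed.

(** * The tolerance, the harmonic sum and a gcd sum *)

Definition tolerance (R : realType) (k n : nat) : R := (n%:R `^ k%:R^-1)^-1.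

Definition harmonic_sum (R : realType) (N : nat) : R := \sum_(1 <= n < N) n%:R^-1.

Lemma tolerance_gt0 (R : realType) k n : (0 < n)%N -> 0 < tolerance R k n.
Proof. by move=> n0; rewrite invr_gt0 powR_gt0// ltr0n. Qed.

Lemma tolerance_ge0 (R : realType) k n : 0 <= tolerance R k n.
Proof. by rewrite invr_ge0 powR_ge0. Qed.

Lemma toleranceX (R : realType) k n : (0 < k)%N -> tolerance R k n ^+ k = n%:R^-1.
Proof.
move=> k0; rewrite exprVn -powR_mulrn ?powR_ge0// -powRrM mulVf.
  by rewrite powRr1.
by rewrite pnatr_eq0 -lt0n.
Qed.

Lemma le_tolerance (R : realType) k n m : (0 < n)%N -> (n <= m)%N ->
  tolerance R k m <= tolerance R k n.
Proof.
move=> n0 nm; rewrite lef_pV2 ?posrE ?powR_gt0 ?ltr0n ?(leq_trans n0)//.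
by apply: ge0_ler_powR; rewrite ?nnegrE ?invr_ge0// ler_nat.
Qed.

Lemma tolerance_le1 (R : realType) k n : (0 < n)%N -> tolerance R k n <= 1.
Proof.
move=> n0; apply: le_trans (le_tolerance _ _ _ n0) _ => //.
by rewrite /tolerance powR1 invr1.
Qed.

Lemma toleranceM (R : realType) k n m : tolerance R k (n * m) = tolerance R k n * tolerance R k m.
Proof. by rewrite /tolerance natrM powRM// invfM. Qed.

(** Convergence of the sum of d^(-1-1/k) by telescoping: for d >= 2 the d-th term is at
most k times the decrease from (d-1)^(-1/k) to d^(-1/k). *)
Lemma tolerance_sum_le (R : realType) k N : (0 < k)%N ->
  \sum_(1 <= d < N) tolerance R k d / d%:R <= 1 + k%:R.
Proof.
move=> k0; have k0R : 0 <= k%:R :> R by [].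
have H M : \sum_(1 <= d < M.+2) tolerance R k d / d%:R <= 1 + k%:R * (1 - tolerance R k M.+1).
  elim: M => [|M IH].
    by rewrite big_nat1 /tolerance !(powR1, invr1, divr1, mulr1, subrr, mulr0, addr0).
  rewrite big_nat_recr//=.
  have step : tolerance R k M.+2 / M.+2%:R <= k%:R * (tolerance R k M.+1 - tolerance R k M.+2).
    set x := tolerance R k M.+1; set y := tolerance R k M.+2.
    have x0 : 0 < x by exact: tolerance_gt0.
    have y0 : 0 < y by exact: tolerance_gt0.
    have yx : y <= x by exact: le_tolerance.
    have E : x ^+ k / M.+2%:R = x ^+ k - y ^+ k.
      have w0 : 0 < M.+1%:R :> R by rewrite ltr0n.
      rewrite !toleranceX// -[M.+2%:R]natr1; move: (M.+1%:R) w0 => w w0.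
      by field; rewrite !gt_eqF//; lra.
    apply: (@le_trans _ _ (x / M.+2%:R)); first by rewrite ler_wpM2r// invr_ge0.
    rewrite -(@ler_pM2l _ (x ^+ k.-1)) ?exprn_gt0// mulrA -exprSr prednK// E.
    rewrite subrXX (_ : _ * (k%:R * _) = (x - y) * (x ^+ k.-1 * k%:R)); last first.
      by ring.
    rewrite ler_wpM2l ?subr_ge0// mulr_natr -[X in _ <= _ *+ X](card_ord k) -sumr_const.
    apply: ler_sum => i _.
    have ik : (i <= k.-1)%N by rewrite -ltnS prednK.
    rewrite -[in leRHS](subnK ik) exprD.
    by rewrite ler_wpM2l ?exprn_ge0 ?(ltW x0)// lerXn2r// ?nnegrE ltW.
  apply: le_trans (lerD IH step) _; rewrite -addrA lerD2l -mulrDr.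
  by rewrite ler_wpM2l//; lra.
case: N => [|[|M]]; first by rewrite big_geq// addr_ge0.
  by rewrite big_geq// addr_ge0.
apply: le_trans (H M) _; rewrite lerD2l ler_piMr//.
by have := tolerance_ge0 R k M.+1; lra.
Qed.

Lemma sum_multiples_le (R : realType) (d N : nat) (g : nat -> R) :
  (0 < d)%N -> (forall n, 0 <= g n) ->
  \sum_(1 <= n < N) (d %| n)%N%:R * g n <= \sum_(1 <= n < N) g (d * n)%N.
Proof.
move=> d0 g0.
apply: (@le_trans _ _ (\sum_(1 <= n < N) \sum_(1 <= n' < N)
   (n == d * n')%N%:R * g (d * n')%N)).
  rewrite big_nat [leRHS]big_nat; apply: ler_sum => n /andP[n1 nN].
  have S0 : 0 <= \sum_(1 <= n' < N) (n == d * n')%N%:R * g (d * n')%N.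
    by apply: sumr_ge0 => *; rewrite mulr_ge0.
  have [/dvdnP[n' nE]|_] := boolP (d %| n)%N; last by rewrite mul0r.
  have n'0 : (0 < n')%N by move: n1; rewrite nE muln_gt0 => /andP[].
  have n'N : (n' < N)%N by apply: leq_trans nN; rewrite ltnS nE leq_pmulr.
  rewrite (big_rem n') ?mem_index_iota ?n'0//= nE mulnC eqxx lerDl.
  by apply: sumr_ge0 => *; rewrite mulr_ge0.
rewrite exchange_big/=; apply: ler_sum => n' _; rewrite -mulr_suml.
rewrite ler_piMl// -natr_sum lern1.
rewrite -big_mkcond/= sum1_count -/(pred1 _) (eq_count (a2 := pred1 (d * n')%N))//.
by rewrite count_uniq_mem ?iota_uniq// leq_b1.
Qed.

Lemma gcd_le_sum (R : realType) (n m N : nat) : (0 < n < N)%N ->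
  (gcdn n m)%:R <= \sum_(1 <= d < N) (d %| n)%N%:R * ((d %| m)%N%:R * d%:R) :> R.
Proof.
move=> /andP[n0 nN].
have g0 : (0 < gcdn n m)%N by rewrite gcdn_gt0 n0.
rewrite (big_rem (gcdn n m)); last first.
  rewrite mem_index_iota g0/=; apply: leq_ltn_trans nN.
  by apply: dvdn_leq => //; exact: dvdn_gcdl.
rewrite dvdn_gcdl dvdn_gcdr !mul1r lerDl.
by apply: sumr_ge0 => d _; rewrite !mulr_ge0.
Qed.

(** Bounding gcd n m by the sum of the common divisors d and writing n = d n',
m = d m' factors the sum into a convergent sum over d and a harmonic sum over n'. *)
Lemma gcd_sum_le (R : realType) (k N : nat) : (0 < k)%N ->
  \sum_(1 <= n < N) \sum_(1 <= m < N)
    (m <= n)%N%:R * (tolerance R k m * (gcdn n m)%:R / n%:R ^+ 2)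
  <= (1 + k%:R) * harmonic_sum R N.
Proof.
move=> k0.
pose g d n m : R := (m <= n)%N%:R * (tolerance R k m * d%:R / n%:R ^+ 2).
have g0 d n m : 0 <= g d n m by rewrite /g !mulr_ge0 ?invr_ge0 ?exprn_ge0 ?tolerance_ge0.
apply: (@le_trans _ _ (\sum_(1 <= d < N) \sum_(1 <= n < N) \sum_(1 <= m < N)
   (d %| n)%N%:R * ((d %| m)%N%:R * g d n m))).
  rewrite [leRHS]exchange_big/= big_nat [leRHS]big_nat; apply: ler_sum => n nN.
  rewrite [leRHS]exchange_big/= big_nat [leRHS]big_nat; apply: ler_sum => m mN.
  have := @gcd_le_sum R n m N nN.
  have c0 : 0 <= (m <= n)%N%:R * (tolerance R k m * (n%:R ^+ 2)^-1).
    by rewrite !mulr_ge0 ?tolerance_ge0 ?invr_ge0 ?exprn_ge0.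
  move=> /(ler_wpM2l c0) h.
  apply: le_trans (_ : _ <= (m <= n)%N%:R * (tolerance R k m / n%:R ^+ 2) * (gcdn n m)%:R) _.
    by rewrite le_eqVlt; apply/orP; left; apply/eqP; ring.
  apply: le_trans h _; rewrite mulr_sumr; apply: ler_sum => d _.
  by rewrite /g le_eqVlt; apply/orP; left; apply/eqP; ring.
rewrite /harmonic_sum; apply: le_trans (ler_wpM2r _ (tolerance_sum_le R N k0)); last first.
  by apply: sumr_ge0 => *; rewrite invr_ge0.
rewrite mulr_suml big_nat [leRHS]big_nat; apply: ler_sum => d /andP[d1 dN].
under eq_bigr do rewrite -mulr_sumr.
apply: le_trans (sum_multiples_le N d1 _) _.
  by move=> n; apply: sumr_ge0 => m _; rewrite mulr_ge0.
rewrite mulr_sumr big_nat [leRHS]big_nat; apply: ler_sum => n /andP[n1 nN].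
apply: le_trans (sum_multiples_le N d1 _) _ => //.
have dR : d%:R != 0 :> R by rewrite pnatr_eq0 -lt0n.
have nR : n%:R != 0 :> R by rewrite pnatr_eq0 -lt0n.
apply: (@le_trans _ _ (\sum_(1 <= m < N) (m <= n)%N%:R *
   (tolerance R k d / d%:R / n%:R ^+ 2))).
  rewrite big_nat [leRHS]big_nat; apply: ler_sum => m /andP[m1 mN].
  rewrite /g leq_pmul2l// toleranceM natrM exprMn.
  apply: ler_wpM2l => //.
  rewrite (_ : _ * d%:R / _ = tolerance R k m * (tolerance R k d / d%:R / n%:R ^+ 2)); last first.
    by field; rewrite dR nR.
  by rewrite ler_piMl ?tolerance_le1// !mulr_ge0 ?invr_ge0 ?exprn_ge0 ?tolerance_ge0.
rewrite -mulr_suml.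
apply: le_trans (_ : _ <= n%:R * (tolerance R k d / d%:R / n%:R ^+ 2)) _.
  apply: ler_wpM2r; first by rewrite !mulr_ge0 ?invr_ge0 ?exprn_ge0 ?tolerance_ge0.
  rewrite -natr_sum ler_nat.
  rewrite (@big_cat_nat _ _ _ n.+1)//=.
  rewrite [X in (_ + X)%N]big_nat [X in (_ + X)%N]big1 ?addn0; last first.
    by move=> m /andP[nm _]; rewrite leqNgt nm.
  apply: leq_trans (_ : \sum_(1 <= m < n.+1) 1 <= _)%N.
    by apply: leq_sum => m _; rewrite leq_b1.
  by rewrite sum_nat_const_nat muln1 subn1.
by rewrite le_eqVlt; apply/orP; left; apply/eqP; field; rewrite nR dR.
Qed.

(** * Expanding products of sums *)

Lemma prod_addB_le (R : realDomainType) (I : Type) (s : seq I)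
    (X Y x y : I -> R) :
  (forall i, 0 <= X i <= x i) -> (forall i, 0 <= Y i <= y i) ->
  \prod_(i <- s) (X i + Y i) - \prod_(i <- s) Y i <=
  \prod_(i <- s) (x i + y i) - \prod_(i <- s) y i.
Proof.
move=> hX hY.
have X0 i : 0 <= X i by have /andP[] := hX i.
have Y0 i : 0 <= Y i by have /andP[] := hY i.
have Xx i : X i <= x i by have /andP[] := hX i.
have Yy i : Y i <= y i by have /andP[] := hY i.
elim: s => [|i s IH]; first by rewrite !big_nil.
rewrite !big_cons.
set P := \prod_(j <- s) (X j + Y j) in IH *.
set p := \prod_(j <- s) (x j + y j) in IH *.
set Q := \prod_(j <- s) Y j in IH *; set q := \prod_(j <- s) y j in IH *.
have PQ : 0 <= P - Q.
  rewrite subr_ge0 /P /Q; apply: ler_prod => j _.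
  by rewrite Y0/= lerDr.
have P0 : 0 <= P by apply: prodr_ge0 => j _; rewrite addr_ge0.
have Pp : P <= p.
  by apply: ler_prod => j _; rewrite addr_ge0//= lerD.
rewrite (_ : _ - Y i * Q = X i * P + Y i * (P - Q)); last by ring.
rewrite (_ : _ - y i * q = x i * p + y i * (p - q)); last by ring.
by rewrite lerD// ler_pM.
Qed.

(** Apart from the product of the xi i and the product of the e, every term of the
expansion has at least one factor xi i <= A r and one factor e. *)
Lemma prod_mixed_le (R : realFieldType) (A : R) (l : nat) : 1 <= A ->
  exists2 C : R, 0 <= C & forall (I : Type) (s : seq I) (xi : I -> R) (r e : R),
    size s = l.+1 -> 0 <= r <= 1 -> 0 <= e <= 1 ->
    (forall i, 0 <= xi i <= A * r) ->
    \prod_(i <- s) (xi i + e) - \prod_(i <- s) e <=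
    \prod_(i <- s) xi i + C * (r * e).
Proof.
move=> A1; have A0 : 0 <= A by exact: le_trans A1.
elim: l => [|l [C C0 IH]].
  exists 0 => // I [//|i [|//]] xi r e _ _ _ _.
  by rewrite !big_seq1 mul0r addr0 addrK.
exists (A ^+ l.+1 + A + (A + 1) * C).
  by rewrite !addr_ge0 ?mulr_ge0 ?exprn_ge0 ?addr_ge0.
move=> I [//|i s] xi r e [sl] hr he hxi.
have {IH} := IH I s xi r e sl hr he hxi.
move: hr he => /andP[r0 r1] /andP[e0 e1].
rewrite !big_cons; set P := \prod_(j <- s) (xi j + e).
set X := \prod_(j <- s) xi j; set E := \prod_(j <- s) e => IH.
have xi0 j : 0 <= xi j by have /andP[] := hxi j.
have xiA j : xi j <= A * r by have /andP[] := hxi j.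
have E0 : 0 <= E by apply: prodr_ge0.
have Ee : E <= e.
  rewrite /E big_const_seq count_predT sl -[leRHS]expr1 -Monoid.iteropE.
  by rewrite -[leLHS]/(e ^+ l.+1) ler_wiXn2l.
have X0 : 0 <= X by apply: prodr_ge0.
have XA : X <= A ^+ l.+1 * r.
  apply: (@le_trans _ _ (\prod_(j <- s) (A * r))).
    by apply: ler_prod => j _; rewrite xi0 xiA.
  rewrite big_const_seq count_predT sl -Monoid.iteropE -[leLHS]/((A * r) ^+ l.+1).
  rewrite exprMn ler_wpM2l ?exprn_ge0//.
  by rewrite -[leRHS]expr1 ler_wiXn2l.
have re0 : 0 <= r * e by rewrite mulr_ge0.
have t1 : e * X <= A ^+ l.+1 * (r * e) by rewrite mulrA mulrC ler_wpM2r.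
have t2 : xi i * E <= A * (r * e).
  by rewrite mulrA ler_pM.
have t3 : (xi i + e) * (C * (r * e)) <= (A + 1) * C * (r * e).
  rewrite -mulrA ler_wpM2r// ?mulr_ge0// lerD//.
  by apply: le_trans (xiA i) _; rewrite ler_piMr.
have t4 : (xi i + e) * P <= (xi i + e) * (X + C * (r * e) + E).
  by rewrite ler_wpM2l ?addr_ge0// -lerBlDr.
lra.
Qed.

(** * Boxes around rational points *)

Definition numers (k L n : nat) := {ffun 'I_k -> 'I_(2 * (L * n - 2))}.

(** The points x whose normalized defects (n x_i - p_i) / n^(-1/k) satisfy
a_i <= _ < b_i, where p is the vector of numerators. *)
Definition box (R : realType) (k L n : nat) (a b : 'I_k -> R) (p : numers k L n) :
    set (k.-tuple (measurableTypeR R)) :=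
  [set x | forall i, `[endpoint L n (p i) (a i) (tolerance R k n),
                       endpoint L n (p i) (b i) (tolerance R k n)[%classic (tnth x i)].

Definition overlap_box (R : realType) (k L n m : nat) (a b : 'I_k -> R)
    (p : numers k L n) (q : numers k L m) : R :=
  \prod_(i < k) overlap_at L n m (p i) (q i) (a i) (b i) (tolerance R k n) (tolerance R k m).

Lemma measurable_rect (R : realType) (k : nat)
    (A : 'I_k -> set (measurableTypeR R)) : (forall i, measurable (A i)) ->
  measurable [set x : k.-tuple (measurableTypeR R) | forall i, A i (tnth x i)].
Proof.
move=> mA; rewrite (_ : [set x | _] = \bigcap_(i in [set: 'I_k])
    (fun y : k.-tuple (measurableTypeR R) => tnth y i) @^-1` A i).
  apply: fin_bigcap_measurable => // i _.
  by rewrite -[X in measurable X]setTI; exact: measurable_tnth.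
by apply/seteqP; split=> y /= Ay i => [_|]; exact: Ay.
Qed.

Lemma measurable_box (R : realType) (k L n : nat) (a b : 'I_k -> R) p :
  measurable (@box R k L n a b p).
Proof.
apply: (@measurable_rect R k (fun i => `[endpoint L n (p i) (a i) (tolerance R k n),
  endpoint L n (p i) (b i) (tolerance R k n)[%classic)) => i.
exact: measurable_itv.
Qed.

Lemma lebesgue_boxI (R : realType) (k L n m : nat) (a b : 'I_k -> R)
    (p : numers k L n) (q : numers k L m) :
  lebesgue_Rn R k (box a b p `&` box a b q) = (overlap_box a b p q)%:E.
Proof.
pose A i : set (measurableTypeR R) :=
  `[endpoint L n (p i) (a i) (tolerance R k n), endpoint L n (p i) (b i) (tolerance R k n)[ `&`
  `[endpoint L m (q i) (a i) (tolerance R k m), endpoint L m (q i) (b i) (tolerance R k m)[.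
have mA i : measurable (A i) by apply: measurableI; exact: measurable_itv.
rewrite (_ : _ `&` _ = [set x | forall i, A i (tnth x i)]); last first.
  apply/seteqP; split=> x /=.
    by move=> [h1 h2] i; split; [exact: (h1 i)|exact: (h2 i)].
  by move=> h; split=> i; have [] := h i.
rewrite [LHS](power_measure_rect _ mA) /overlap_box -prodEFin.
apply: eq_bigr => i _; exact: lebesgue_itvI.
Qed.

Section boxes.
Variables (R : realType) (k : nat) (a b : 'I_k -> R).
Hypotheses (k0 : (0 < k)%N) (a0 : forall i, -2 <= a i <= 0)
  (b0 : forall i, 0 <= b i <= 2).

Let ab i : a i <= b i.
Proof. by have /andP[_ h] := a0 i; have /andP[h' _] := b0 i; exact: le_trans h'. Qed.

Definition vol : R := \prod_(i < k) (b i - a i).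

Lemma vol_ge0 : 0 <= vol.
Proof. by apply: prodr_ge0 => i _; rewrite subr_ge0. Qed.

Lemma overlap_box_ge0 L n m (p : numers k L n) (q : numers k L m) :
  0 <= overlap_box a b p q.
Proof. by apply: prodr_ge0 => i _; exact: overlap_ge0. Qed.

Let endpoint_le L n i j : (0 < n)%N ->
  endpoint L n i (a j) (tolerance R k n) <= endpoint L n i (b j) (tolerance R k n).
Proof.
by move=> n0; rewrite ler_wpM2r ?invr_ge0// lerD2l ler_wpM2r// tolerance_ge0.
Qed.

Let endpointB L n i j :
  endpoint L n i (b j) (tolerance R k n) - endpoint L n i (a j) (tolerance R k n) =
  (b j - a j) * tolerance R k n / n%:R.
Proof. by rewrite /endpoint; ring. Qed.

Let prod_len n : \prod_(i < k) ((b i - a i) * tolerance R k n / n%:R) =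
  vol / n%:R ^+ k.+1.
Proof.
rewrite !big_split/= !prodr_const !card_ord toleranceX// -/vol exprS invfM exprVn.
by rewrite mulrA.
Qed.

Lemma overlap_box_le L n m (p : numers k L n) (q : numers k L m) : (0 < n)%N ->
  overlap_box a b p q <= vol / n%:R ^+ k.+1.
Proof.
move=> n0; rewrite -prod_len; apply: ler_prod => i _.
by rewrite overlap_ge0/= -(endpointB L n (p i)) overlap_le ?endpoint_le.
Qed.

Lemma overlap_box_id L n (p : numers k L n) : (0 < n)%N ->
  overlap_box a b p p = vol / n%:R ^+ k.+1.
Proof.
move=> n0; rewrite -prod_len; apply: eq_bigr => i _.
by rewrite -(endpointB L n (p i)) /overlap_at overlap_id ?endpoint_le.
Qed.

Lemma overlap_boxC L n m (p : numers k L n) (q : numers k L m) :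
  overlap_box a b p q = overlap_box a b q p.
Proof.
apply: eq_bigr => i _; rewrite /overlap_at /overlap; congr (Num.max _ (_ - _)).
  exact: minC.
exact: maxC.
Qed.

(** The rational points p/n and q/m coincide. *)
Definition same_point L n m (p : numers k L n) (q : numers k L m) : bool :=
  [forall i, cross L n m (p i) (q i) == 0].

Lemma same_pointC L n m (p : numers k L n) (q : numers k L m) :
  same_point p q = same_point q p.
Proof.
apply: eq_forallb => i; rewrite /cross -oppr_eq0 opprB //.
Qed.

Lemma sum_numers_prod L n m (F : 'I_k -> 'I_(2 * (L * n - 2)) ->
    'I_(2 * (L * m - 2)) -> R) :
  \sum_(p : numers k L n) \sum_(q : numers k L m) \prod_(i < k) F i (p i) (q i) =
  \prod_(i < k) \sum_s \sum_t F i s t.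
Proof.
rewrite [RHS]bigA_distr_bigA; apply: eq_bigr => p _.
by rewrite bigA_distr_bigA.
Qed.

(** Split the sum in each coordinate into equal and distinct fractions, bound the
two parts by overlap_sum_same and overlap_sum_distinct, and expand the product.
The term with all fractions distinct is the expected main term, the one with all
fractions equal is excluded, and prod_mixed_le bounds the others. *)
Lemma distinct_sum_le : exists2 C : R, 0 <= C &
  forall L n m, (0 < m)%N -> (m <= n)%N ->
  \sum_(p : numers k L n) \sum_(q : numers k L m)
     (~~ same_point p q)%:R * overlap_box a b p q <=
  (2 * L)%:R ^+ k * vol ^+ 2 / (n%:R * m%:R) +
  C * (2 * L)%:R ^+ k * vol * (tolerance R k m * (gcdn n m)%:R / n%:R ^+ 2).
Proof.
have [C C0 HC] := @prod_mixed_le R 4 k.-1 (ltac:(lra)).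
exists C => // L n m m0 mn; have n0 : (0 < n)%N := leq_trans m0 mn.
set u := tolerance R k n; set v := tolerance R k m.
have u0 : 0 < u by exact: tolerance_gt0.
have v0 : 0 < v by exact: tolerance_gt0.
have v1 : v <= 1 by exact: tolerance_le1.
have nR : 0 < n%:R :> R by rewrite ltr0n.
have mR : 0 < m%:R :> R by rewrite ltr0n.
have uv : u / n%:R <= v / m%:R.
  apply: ler_pM; rewrite ?invr_ge0 ?(ltW u0)//; first exact: le_tolerance.
  by rewrite lef_pV2 ?posrE// ler_nat.
pose o i s t := overlap_at L n m s t (a i) (b i) u v.
have o0 i s t : 0 <= o i s t by exact: overlap_ge0.
pose X i := \sum_(s < 2 * (L * n - 2)) \sum_(t < 2 * (L * m - 2))
     (cross L n m s t != 0)%:R * o i s t.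
pose Y i := \sum_(s < 2 * (L * n - 2)) \sum_(t < 2 * (L * m - 2))
     (cross L n m s t == 0)%:R * o i s t.
have -> : \sum_(p : numers k L n) \sum_(q : numers k L m)
     (~~ same_point p q)%:R * overlap_box a b p q =
   \prod_(i < k) (X i + Y i) - \prod_(i < k) Y i.
  under [X in X - _]eq_bigr => i _.
    rewrite /X /Y -big_split/=; under eq_bigr => s _.
      rewrite -big_split/=; under eq_bigr => t _.
        rewrite -mulrDl -natrD addn_negb mul1r; over.
      over.
    over.
  rewrite -!sum_numers_prod -sumrB; apply: eq_bigr => p _.
  rewrite -sumrB; apply: eq_bigr => q _.
  rewrite big_split/= -/(overlap_box a b p q).
  rewrite (_ : \prod_(i < k) (_ == _)%:R = (same_point p q)%:R).
    by case: same_point; rewrite ?mul0r ?mul1r ?subrr ?subr0.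
  rewrite /same_point; case: forallP => [h|/forallP].
    by rewrite big1// => i _; rewrite h.
  by rewrite negb_forall => /existsP[i /negbTE hi]; rewrite (bigD1 i)//= hi mul0r.
set e : R := (gcdn n m)%:R / n%:R.
have e0 : 0 <= e by rewrite divr_ge0.
have e1 : e <= 1.
  by rewrite ler_pdivrMr// mul1r ler_nat dvdn_leq// dvdn_gcdl.
pose c i := (2 * L)%:R * (b i - a i) * u.
have c0 i : 0 <= c i by rewrite /c !mulr_ge0 ?subr_ge0// ltW.
apply: le_trans (@prod_addB_le _ _ _ X Y (fun i => c i * ((b i - a i) * v))
   (fun i => c i * e) _ _) _.
- move=> i; apply/andP; split.
    by apply: sumr_ge0 => s _; apply: sumr_ge0 => t _; rewrite mulr_ge0.
  apply: le_trans (overlap_sum_distinct _ _ _ _ _ _ _ uv) _ => //.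
  + by have /andP[] := a0 i.
  + by have /andP[] := b0 i.
  + exact: ltW.
  + exact: ltW.
  by rewrite le_eqVlt; apply/orP; left; apply/eqP; rewrite /c; ring.
- move=> i; apply/andP; split.
    by apply: sumr_ge0 => s _; apply: sumr_ge0 => t _; rewrite mulr_ge0.
  exact: overlap_sum_same (ltW u0).
under eq_bigr do rewrite -mulrDr.
rewrite (big_split _ _ _ c)/= (big_split _ _ _ c)/= -mulrBr.
have -> : \prod_(i < k) c i = (2 * L)%:R ^+ k * vol / n%:R.
  by rewrite /c !big_split/= !prodr_const !card_ord toleranceX.
have := @HC _ (index_enum 'I_k) (fun i => (b i - a i) * v) v e.
have sk : size (index_enum 'I_k) = k.-1.+1.
  by rewrite prednK// /index_enum -enumT size_enum_ord.
rewrite v1 (ltW v0) e0 e1 => /(_ sk isT isT) h.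
have K0 : 0 <= (2 * L)%:R ^+ k * vol / n%:R.
  by rewrite !mulr_ge0 ?vol_ge0 ?exprn_ge0 ?invr_ge0.
apply: le_trans (ler_wpM2l K0 (h _)) _.
  move=> i; rewrite mulr_ge0 ?subr_ge0 ?(ltW v0)//= ler_wpM2r ?(ltW v0)//.
  by have /andP[h1 _] := a0 i; have /andP[_ h2] := b0 i; lra.
rewrite big_split/= prodr_const card_ord toleranceX// -/vol /e.
by rewrite le_eqVlt; apply/orP; left; apply/eqP; field; rewrite !gt_eqF.
Qed.

End boxes.

(** * First and second moments as finite sums *)

Lemma harmonic_sum_ge0 (R : realType) N : 0 <= harmonic_sum R N.
Proof. by apply: sumr_ge0 => n _; rewrite invr_ge0. Qed.

(** 1 / g^2 is at most 1 / (g - 1) - 1 / g. *)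
Lemma sum_inv_sqr_le (R : realType) (K N : nat) : (0 < K)%N ->
  \sum_(K.+1 <= g < N) (g%:R ^+ 2)^-1 <= K%:R^-1 :> R.
Proof.
move=> K0.
have H M : \sum_(K.+1 <= g < K.+1 + M) (g%:R ^+ 2)^-1 <= K%:R^-1 - (K + M)%:R^-1 :> R.
  elim: M => [|M IH]; first by rewrite !addn0 big_geq// subrr.
  rewrite addnS big_nat_recr ?leq_addr//=.
  apply: le_trans (lerD IH (lexx _)) _; rewrite addrAC -addrA lerD2l.
  rewrite addSn addnS -natr1.
  have w0 : 0 < (K + M)%:R :> R by rewrite ltr0n addn_gt0 K0.
  move: (_ + _)%:R w0 => w w0.
  rewrite lerBlDr -subr_ge0.
  rewrite (_ : _ - _ = w^-1 * ((w + 1) ^- 2)); last by field; rewrite !gt_eqF//; lra.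
  by rewrite mulr_ge0 ?invr_ge0 ?exprn_ge0//; lra.
have [NK|KN] := leqP N K.+1; first by rewrite big_geq// invr_ge0.
have := H (N - K.+1)%N; rewrite subnKC ?(ltnW KN)// => /le_trans; apply.
by rewrite gerBl invr_ge0.
Qed.

Section common_divisor.
Variables (k L : nat).

Definition common_divisor (n : nat) (p : numers k L n) : nat :=
  gcdn n (\big[gcdn/0]_(i < k) `|numer L n (p i)|)%N.

Lemma common_divisor_dvd n (p : numers k L n) (g : nat) :
  (g %| common_divisor p)%N = (g %| n)%N && [forall i, g %| `|numer L n (p i)|]%N.
Proof.
rewrite dvdn_gcd; congr (_ && _); apply/dvdn_biggcdP/forallP => h i //.
exact: h.
Qed.

Lemma same_point_inj n m (p : numers k L n) (q q' : numers k L m) : (0 < n)%N ->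
  same_point p q -> same_point p q' -> q = q'.
Proof.
move=> n0 /forallP h /forallP h'; apply/ffunP => i; apply: val_inj.
move: (h i) (h' i); rewrite /cross /numer => /eqP e /eqP e'.
have : ((q i : nat)%:Z - (q' i : nat)%:Z) * n%:Z = 0 by move: e e'; lia.
by move/eqP; rewrite mulf_eq0 subr_eq0 => /orP[/eqP[]//|]; lia.
Qed.

Lemma same_point_dvd n m (p : numers k L n) (q : numers k L m) :
  same_point p q -> (n %| m * common_divisor p)%N.
Proof.
move=> /forallP h; rewrite /common_divisor muln_gcdr dvdn_gcd dvdn_mull//=.
have : (n %| \big[gcdn/0]_(i < k) (m * `|numer L n (p i)|))%N.
  apply/dvdn_biggcdP => i _; move: (h i); rewrite /cross subr_eq0 => /eqP e.
  have : (n%:Z %| numer L n (p i) * m%:Z)%Z by rewrite e dvdz_mull.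
  by rewrite dvdzE/= abszM mulnC.
rewrite (_ : \big[gcdn/0]_(i < k) (m * _)%N =
  (m * \big[gcdn/0]_(i < k) `|numer L n (p i)|)%N)//.
by apply: (big_ind2 (fun x y => x = (m * y)%N)) => // [|x1 x2 y1 y2 -> ->];
  rewrite ?muln0// muln_gcdr.
Qed.

(** p/n = q/m forces m to be a multiple of n / common_divisor p, and then determines
q. *)
Lemma same_point_count n (p : numers k L n) : (0 < n)%N ->
  (\sum_(1 <= m < n.+1) \sum_(q : numers k L m) same_point p q <= common_divisor p)%N.
Proof.
move=> n0; have c0 : (0 < common_divisor p)%N by rewrite gcdn_gt0 n0.
have cn : (common_divisor p %| n)%N by exact: dvdn_gcdl.
apply: (@leq_trans (\sum_(1 <= m < n.+1) (n %/ common_divisor p %| m)%N)).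
  apply: leq_sum => m _.
  have [[q pq]|nopq] := pselect (exists q : numers k L m, same_point p q).
    rewrite (_ : (_ %| _)%N = true); last first.
      by rewrite -(dvdn_pmul2r c0) divnK// (same_point_dvd pq).
    rewrite (bigD1 q)//= pq big1// => q' q'q.
    apply/eqP; rewrite eqb0; apply: contraNN q'q => pq'.
    by apply/eqP; exact: same_point_inj pq' pq.
  rewrite big1// => q _; apply/eqP; rewrite eqb0; apply/negP => pq.
  by apply: nopq; exists q.
rewrite -divn_count_dvd.
rewrite leq_divLR ?(mulnC (common_divisor p)) ?divnK//.
by apply/dvdnP; exists (common_divisor p); rewrite mulnC divnK.
Qed.

Lemma numer_dvd_count n g : (0 < g)%N -> (g %| n)%N ->
  (\sum_(s < 2 * (L * n - 2)) (g %| `|numer L n s|) <= 2 * L * (n %/ g))%N.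
Proof.
move=> g0 gn; rewrite -big_mkcond/= sum1_card.
apply: (@count_class _ _ g) => //.
  by rewrite -mulnA divnK// -mulnA leq_mul2l leq_subr orbT.
move=> s t; rewrite /numer => hs ht.
have : (g%:Z %| s%:Z - t%:Z)%Z.
  rewrite (_ : _ - _ = numer L n s - numer L n t); last by rewrite /numer; lia.
  by rewrite rpredB// dvdzE.
by rewrite -eqz_mod_dvd => /eqP; rewrite !modz_nat => -[].
Qed.

End common_divisor.

Section moments.
Variables (R : realType) (k : nat) (a b : 'I_k -> R).
Hypotheses (k0 : (0 < k)%N) (a0 : forall i, -2 <= a i <= 0)
  (b0 : forall i, 0 <= b i <= 2).
Local Notation vol := (vol a b).
Local Notation ov := (overlap_box a b).

Lemma card_numers_le L n : #|{: numers k L n}|%:R <= (2 * L)%:R ^+ k * n%:R ^+ k :> R.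
Proof.
rewrite card_ffun !card_ord -exprMn -natrM -natrX ler_nat leq_exp2r//.
by rewrite -mulnA leq_mul2l leq_subr orbT.
Qed.

(** By overlap_box_le each pair contributes at most the measure of one box, and
same_point_count leaves at most K choices of (m, q) with m <= n for given (n, p). *)
Lemma same_sum_le L K N :
  \sum_(1 <= n < N) \sum_(1 <= m < N) (m <= n)%N%:R *
    \sum_(p : numers k L n) \sum_(q : numers k L m)
      ((common_divisor p <= K)%N && same_point p q)%:R * ov p q
  <= K%:R * (2 * L)%:R ^+ k * vol * harmonic_sum R N.
Proof.
have v0 : 0 <= vol by exact: vol_ge0.
rewrite /harmonic_sum mulr_sumr big_nat [leRHS]big_nat; apply: ler_sum => n /andP[n0 nN].
have nR : 0 < n%:R :> R by rewrite ltr0n.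
apply: (@le_trans _ _ (\sum_(p : numers k L n) K%:R * (vol / n%:R ^+ k.+1))).
  under eq_bigr do rewrite mulr_sumr.
  rewrite exchange_big/=; apply: ler_sum => p _.
  rewrite (@big_cat_nat _ _ _ n.+1)//=.
  rewrite [X in _ + X]big_nat [X in _ + X]big1 ?addr0; last first.
    by move=> m /andP[nm _]; rewrite leqNgt nm mul0r.
  have [pK|pK] := leqP (common_divisor p) K; last first.
    rewrite big1 ?mulr_ge0 ?invr_ge0 ?exprn_ge0// => m _.
    by rewrite big1 ?mulr0// => q _; rewrite mul0r.
  apply: (@le_trans _ _ (\sum_(1 <= m < n.+1) \sum_(q : numers k L m)
      (same_point p q)%:R * (vol / n%:R ^+ k.+1))).
    apply: ler_sum => m _; apply: le_trans (_ : _ <= 1 * _) _.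
      by apply: ler_wpM2r; rewrite ?lern1 ?leq_b1// sumr_ge0// => q _;
        rewrite mulr_ge0// overlap_box_ge0.
    rewrite mul1r; apply: ler_sum => q _; rewrite ler_wpM2l//.
    exact: overlap_box_le.
  under eq_bigr do rewrite -mulr_suml.
  rewrite -mulr_suml ler_wpM2r ?mulr_ge0 ?invr_ge0 ?exprn_ge0//.
  under eq_bigr do rewrite -natr_sum.
  by rewrite -natr_sum ler_nat (leq_trans (same_point_count p n0)).
rewrite sumr_const -[_ *+ _]mulr_natl.
apply: le_trans (ler_wpM2r _ (card_numers_le L n)) _.
  by rewrite !mulr_ge0 ?invr_ge0 ?exprn_ge0.
by rewrite le_eqVlt; apply/orP; left; apply/eqP; rewrite [_ ^+ k.+1]exprS; field;
  rewrite ?expf_neq0 ?lt0r_neq0.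
Qed.

(** The pairs are ordered by n and m.  Those of distinct points are bounded by
distinct_sum_le together with gcd_sum_le, the others by same_sum_le. *)
Lemma second_moment_le L : exists2 C : R, 0 <= C & forall K N, (0 < K)%N ->
  \sum_(1 <= n < N) \sum_(1 <= m < N) \sum_(p : numers k L n) \sum_(q : numers k L m)
      ((common_divisor p <= K)%N && (common_divisor q <= K)%N)%:R * ov p q
  <= (2 * L)%:R ^+ k * vol ^+ 2 * harmonic_sum R N ^+ 2 + C * K%:R * harmonic_sum R N.
Proof.
have [C C0 HC] := distinct_sum_le k0 a0 b0.
have v0 : 0 <= vol by exact: vol_ge0.
set W : R := (2 * L)%:R ^+ k; have W0 : 0 <= W by rewrite exprn_ge0.
exists (2 * W * vol * (C * (1 + k%:R) + 1)).
  by rewrite !(mulr_ge0, addr_ge0).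
move=> K N K0; have K1 : 1 <= K%:R :> R by rewrite ler1n.
have h0 := harmonic_sum_ge0 R N.
pose D n m := \sum_(p : numers k L n) \sum_(q : numers k L m) (~~ same_point p q)%:R * ov p q.
pose E n m := (m <= n)%N%:R * \sum_(p : numers k L n) \sum_(q : numers k L m)
      ((common_divisor p <= K)%N && same_point p q)%:R * ov p q.
pose G n m : R := (m <= n)%N%:R * (tolerance R k m * (gcdn n m)%:R / n%:R ^+ 2).
have G0 n m : 0 <= G n m.
  by rewrite /G !mulr_ge0 ?invr_ge0 ?exprn_ge0 ?tolerance_ge0.
have E0 n m : 0 <= E n m.
  rewrite mulr_ge0// sumr_ge0// => p _; rewrite sumr_ge0// => q _.
  by rewrite mulr_ge0 ?overlap_box_ge0.
have DC n m : D n m = D m n.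
  rewrite /D exchange_big/=; apply: eq_bigr => q _; apply: eq_bigr => p _.
  by rewrite same_pointC overlap_boxC.
have Dle n m : (0 < n)%N -> (0 < m)%N ->
    D n m <= W * vol ^+ 2 / (n%:R * m%:R) + C * W * vol * (G n m + G m n).
  move=> n0 m0; have CW0 : 0 <= C * W * vol by rewrite !mulr_ge0.
  have [mn|/ltnW nm] := leqP m n.
    apply: le_trans (HC L n m m0 mn) _; rewrite lerD2l ler_wpM2l//.
    apply: le_trans (_ : G n m <= _); last by rewrite lerDl.
    by rewrite /G mn mul1r.
  rewrite DC; apply: le_trans (HC L m n n0 nm) _.
  rewrite [n%:R * m%:R]mulrC lerD2l ler_wpM2l//.
  apply: le_trans (_ : G m n <= _); last by rewrite lerDr.
  by rewrite /G nm mul1r.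
apply: (@le_trans _ _ (\sum_(1 <= n < N) \sum_(1 <= m < N)
    ((W * vol ^+ 2 / (n%:R * m%:R) + C * W * vol * (G n m + G m n)) +
     (E n m + E m n)))).
  rewrite big_nat [leRHS]big_nat; apply: ler_sum => n /andP[n0 _].
  rewrite big_nat [leRHS]big_nat; apply: ler_sum => m /andP[m0 _].
  apply: le_trans (lerD (Dle _ _ n0 m0) (lexx _)).
  have split_le : \sum_(p : numers k L n) \sum_(q : numers k L m)
      ((common_divisor p <= K)%N && (common_divisor q <= K)%N)%:R * ov p q <=
      D n m + \sum_(p : numers k L n) \sum_(q : numers k L m)
      ([&& common_divisor p <= K, common_divisor q <= K & same_point p q]%N)%:R * ov p q.
    rewrite /D -big_split/=; apply: ler_sum => p _.
    rewrite -big_split/=; apply: ler_sum => q _; rewrite -mulrDl.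
    rewrite ler_wpM2r ?overlap_box_ge0//.
    by case: (common_divisor p <= K)%N; case: (common_divisor q <= K)%N; case: same_point;
      rewrite /= ?addr0 ?add0r.
  apply: le_trans split_le _; rewrite lerD2l.
  have [mn|/ltnW nm] := leqP m n.
    apply: le_trans (_ : E n m <= _); last by rewrite lerDl.
    rewrite /E mn mul1r; apply: ler_sum => p _; apply: ler_sum => q _.
    rewrite ler_wpM2r ?overlap_box_ge0//.
    by case: (common_divisor p <= K)%N; case: (common_divisor q <= K)%N.
  apply: le_trans (_ : E m n <= _); last by rewrite lerDr.
  rewrite /E nm mul1r exchange_big/=; apply: ler_sum => p _; apply: ler_sum => q _.
  rewrite overlap_boxC same_pointC ler_wpM2r ?overlap_box_ge0//.
  by case: (common_divisor p <= K)%N; case: (common_divisor q <= K)%N.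
under eq_bigr do rewrite !big_split/=.
rewrite !big_split/=.
have -> : \sum_(1 <= n < N) \sum_(1 <= m < N) W * vol ^+ 2 / (n%:R * m%:R) =
   W * vol ^+ 2 * harmonic_sum R N ^+ 2.
  rewrite [harmonic_sum R N ^+ 2]expr2 {1}/harmonic_sum mulr_suml mulr_sumr; apply: eq_bigr => n _.
  rewrite /harmonic_sum !mulr_sumr; apply: eq_bigr => m _.
  by rewrite invfM.
under [X in _ + X + _ <= _]eq_bigr do rewrite -mulr_sumr.
rewrite -mulr_sumr.
have GE : \sum_(1 <= n < N) \sum_(1 <= m < N) (G n m + G m n) <=
    2 * ((1 + k%:R) * harmonic_sum R N).
  under eq_bigr do rewrite big_split/=.
  rewrite big_split/= [X in _ + X]exchange_big/=.
  have := gcd_sum_le R N k0; rewrite -/(G _ _) => h.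
  by rewrite mulr_natl mulr2n lerD.
have EE : \sum_(1 <= n < N) \sum_(1 <= m < N) E n m +
    \sum_(1 <= n < N) \sum_(1 <= m < N) E m n <=
    2 * (K%:R * W * vol * harmonic_sum R N).
  rewrite [X in _ + X]exchange_big/= mulr_natl mulr2n.
  by rewrite lerD// same_sum_le.
have CG : C * W * vol * \sum_(1 <= n < N) \sum_(1 <= m < N) (G n m + G m n) <=
   C * W * vol * (2 * ((1 + k%:R) * harmonic_sum R N)) * K%:R.
  apply: le_trans (_ : C * W * vol * (2 * ((1 + k%:R) * harmonic_sum R N)) <= _).
    by rewrite ler_wpM2l// !mulr_ge0.
  by rewrite ler_peMr// !(mulr_ge0, addr_ge0).
rewrite -addrA lerD2l; apply: le_trans (lerD CG EE) _.
by rewrite le_eqVlt; apply/orP; left; apply/eqP; ring.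
Qed.

(** Grouping by the common divisor g > K and writing n = g n', the sum over n' is
harmonic and the sum over g is bounded by the tail of the sum of 1 / g^2. *)
Lemma bad_mean_le L K N : (0 < K)%N ->
  \sum_(1 <= n < N) \sum_(p : numers k L n) (K < common_divisor p)%N%:R * ov p p
  <= (2 * L)%:R ^+ k * vol * harmonic_sum R N / K%:R.
Proof.
move=> K0.
have v0 : 0 <= vol by exact: vol_ge0.
pose F g n : R := (g %| n)%N%:R * ((2 * L)%:R ^+ k * vol * (g%:R ^+ k)^-1 / n%:R).
apply: (@le_trans _ _ (\sum_(1 <= n < N) \sum_(K.+1 <= g < N) F g n)).
  rewrite big_nat [leRHS]big_nat; apply: ler_sum => n /andP[n0 nN].
  have nR : 0 < n%:R :> R by rewrite ltr0n.
  apply: (@le_trans _ _ (\sum_(p : numers k L n) \sum_(K.+1 <= g < N)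
     (g %| n)%N%:R * \prod_(i < k) (g %| `|numer L n (p i)|)%N%:R *
     (vol / n%:R ^+ k.+1))).
    apply: ler_sum => p _; rewrite overlap_box_id//.
    rewrite -mulr_suml ler_wpM2r ?mulr_ge0 ?invr_ge0 ?exprn_ge0//.
    have S0 g : 0 <= (g %| n)%N%:R * \prod_(i < k) (g %| `|numer L n (p i)|)%N%:R :> R.
      by rewrite mulr_ge0// prodr_ge0.
    have [Kc|_] := ltnP K (common_divisor p); last exact: sumr_ge0.
    have := dvdnn (common_divisor p); rewrite common_divisor_dvd => /andP[cn /forallP cp].
    rewrite (big_rem (common_divisor p)) ?mem_index_iota ?Kc/=; last first.
      by apply: leq_ltn_trans nN; rewrite dvdn_leq.
    rewrite cn mul1r big1 ?lerDl ?sumr_ge0// => i _.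
    by rewrite cp.
  rewrite exchange_big/= big_nat [leRHS]big_nat; apply: ler_sum => g /andP[Kg _].
  have g0 : (0 < g)%N by exact: leq_ltn_trans Kg.
  have gR : 0 < g%:R :> R by rewrite ltr0n.
  rewrite -mulr_suml -mulr_sumr /F -mulrA.
  have [gn|] := boolP (g %| n)%N; last by rewrite !mul0r.
  rewrite !mul1r.
  rewrite -(bigA_distr_bigA (fun (i : 'I_k) (s : 'I_(2 * (L * n - 2))) =>
     (g %| `|numer L n s|)%N%:R : R)).
  rewrite prodr_const card_ord.
  apply: (@le_trans _ _ (((2 * L)%:R * (n%:R / g%:R)) ^+ k * (vol / n%:R ^+ k.+1))).
    rewrite ler_wpM2r ?mulr_ge0 ?invr_ge0 ?exprn_ge0//.
    rewrite lerXn2r ?nnegrE ?sumr_ge0 ?mulr_ge0 ?invr_ge0//.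
    rewrite -natr_sum; apply: le_trans (_ : (2 * L * (n %/ g))%:R <= _).
      by rewrite ler_nat numer_dvd_count.
    by rewrite natrM ler_wpM2l// ler_pdivlMr// -natrM divnK.
  rewrite !exprMn exprVn le_eqVlt; apply/orP; left; apply/eqP.
  by rewrite exprS; field; rewrite !expf_neq0 gt_eqF.
rewrite exchange_big/=.
apply: (@le_trans _ _ (\sum_(K.+1 <= g < N) (2 * L)%:R ^+ k * vol * harmonic_sum R N *
   (g%:R ^+ 2)^-1)).
  rewrite big_nat [leRHS]big_nat; apply: ler_sum => g /andP[Kg _].
  have g0 : (0 < g)%N by exact: leq_ltn_trans Kg.
  have gR : 0 < g%:R :> R by rewrite ltr0n.
  apply: le_trans (sum_multiples_le N g0 _) _.
    by move=> n; rewrite !mulr_ge0 ?invr_ge0 ?exprn_ge0.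
  under eq_bigr do rewrite (natrM _ g) invfM !mulrA.
  rewrite -mulr_sumr -/(harmonic_sum R N) -[leRHS]mulrAC.
  rewrite ler_wpM2r ?harmonic_sum_ge0// -!mulrA !ler_wpM2l ?exprn_ge0//.
  rewrite -invfM lef_pV2 ?posrE ?mulr_gt0 ?exprn_gt0//.
  by rewrite -exprSr ler_weXn2l// ler1n.
rewrite -mulr_sumr ler_wpM2l ?sum_inv_sqr_le//.
by rewrite !mulr_ge0 ?exprn_ge0 ?harmonic_sum_ge0.
Qed.

(** The margin left by numer costs a relative error O(1 / n) at denominator n, which
is summable against 1 / n. *)
Lemma mean_ge L N : (0 < L)%N ->
  (2 * L)%:R ^+ k * vol * (harmonic_sum R N - 4 * k%:R) <=
  \sum_(1 <= n < N) \sum_(p : numers k L n) ov p p.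
Proof.
move=> L0; have v0 : 0 <= vol by exact: vol_ge0.
have LR : 1 <= L%:R :> R by rewrite ler1n.
have sq2 : \sum_(1 <= n < N) (n%:R ^+ 2)^-1 <= 2 :> R.
  have [N1|N1] := leqP N 1; first by rewrite big_geq.
  rewrite big_ltn// expr1n invr1; have := @sum_inv_sqr_le R 1 N isT.
  rewrite invr1; lra.
apply: (@le_trans _ _ (\sum_(1 <= n < N) (2 * L)%:R ^+ k * vol *
   (n%:R^-1 - 2 * k%:R * (n%:R ^+ 2)^-1))).
  rewrite -mulr_sumr ler_wpM2l ?mulr_ge0 ?exprn_ge0//.
  rewrite sumrB -/(harmonic_sum R N) lerD2l lerN2 -mulr_sumr.
  have := ler_wpM2l (_ : 0 <= 2 * k%:R) sq2.
  by rewrite mulr_ge0// => /(_ isT) /le_trans; apply; lra.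
rewrite big_nat [leRHS]big_nat; apply: ler_sum => n /andP[n0 _].
have nR : 0 < n%:R :> R by rewrite ltr0n.
under eq_bigr do rewrite overlap_box_id//.
rewrite sumr_const card_ffun !card_ord -[leRHS]mulr_natl natrX.
have key : (2 * L)%:R ^+ k * (n%:R ^+ k * (1 - 2 * k%:R / n%:R)) <=
    (2 * (L * n - 2))%:R ^+ k :> R.
  have [n2|n2] := leqP 2 (L * n)%N; last first.
    (* there are no numerators, and the left-hand side is nonpositive *)
    have n1 : n = 1%N by case: (n) n0 n2 => [|[|n']]//; case: (L) L0 => // l; lia.
    apply: le_trans (_ : 0 <= _); last by rewrite exprn_ge0.
    rewrite !mulr_ge0_le0 ?exprn_ge0// n1 divr1.
    have : 1 <= k%:R :> R by rewrite ler1n.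
    lra.
  rewrite !natrM natrB// natrM !exprMn -[leLHS]mulrA ler_wpM2l ?exprn_ge0//.
  have Ln : 0 < L%:R * n%:R :> R by rewrite mulr_gt0// (lt_le_trans ltr01).
  rewrite (_ : L%:R * n%:R - 2 = L%:R * n%:R * (1 - 2 / (L%:R * n%:R))); last first.
    by field; rewrite !gt_eqF// (lt_le_trans ltr01).
  rewrite exprMn [in leRHS]exprMn -[leRHS]mulrA !ler_wpM2l ?exprn_ge0//.
  set x := 2 / (L%:R * n%:R).
  have x1 : x <= 1 by rewrite /x ler_pdivrMr// mul1r -natrM ler_nat.
  have x0 : 0 <= x by rewrite divr_ge0// ltW.
  have xn : x <= 2 / n%:R.
    by rewrite ler_pM// ?invr_ge0 ?(ltW Ln)// lef_pV2 ?posrE// ler_peMl// ltW.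
  have bern j : 1 - j%:R * x <= (1 - x) ^+ j.
    elim: j => [|j IH]; first by rewrite mul0r subr0 expr0.
    rewrite exprS; apply: le_trans (ler_wpM2l _ IH); last by lra.
    have : 0 <= j%:R * x ^+ 2 by rewrite mulr_ge0 ?exprn_ge0.
    rewrite -natr1; nra.
  apply: le_trans (bern k); rewrite lerD2l lerN2.
  rewrite (_ : 2 * k%:R / n%:R = k%:R * (2 / n%:R)); last by ring.
  by rewrite ler_wpM2l.
apply: le_trans (ler_wpM2r _ key); last by rewrite !mulr_ge0 ?invr_ge0 ?exprn_ge0.
by rewrite le_eqVlt; apply/orP; left; apply/eqP; rewrite [_ ^+ k.+1]exprS; field;
  rewrite ?expf_neq0 ?lt0r_neq0.
Qed.

End moments.

(** * Integrals of nonnegative functions with a known finite value *)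

Section integral_value.
Context d (T : measurableType d) (R : realType).
Variables (mu : {measure set T -> \bar R}) (D : set T) (mD : measurable D).

(** Bundling measurability, nonnegativity and the value of the integral lets the
integrals of nested finite sums be computed by following their structure. *)
Definition integral_value (f : T -> R) (m : R) : Prop :=
  [/\ measurable_fun D f, (forall x, D x -> 0 <= f x) &
      (\int[mu]_(x in D) (f x)%:E = m%:E)%E].

Lemma integral_value_sum (I : Type) (s : seq I) (f : I -> T -> R) (m : I -> R) :
  (forall i, integral_value (f i) (m i)) ->
  integral_value (fun x => \sum_(i <- s) f i x) (\sum_(i <- s) m i).
Proof.
move=> h; split.
- by apply: measurable_sum => i; have [] := h i.
- by move=> x Dx; apply: sumr_ge0 => i _; have [_ + _] := h i; apply.
under eq_integral do rewrite -sumEFin.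
rewrite ge0_integral_sum//.
- by rewrite -sumEFin; apply: eq_bigr => i _; have [] := h i.
- by move=> i; apply/measurable_EFinP; have [] := h i.
- by move=> i x Dx; rewrite lee_fin; have [_ + _] := h i; apply.
Qed.

Lemma integral_valueZ (c : R) (f : T -> R) (m : R) : 0 <= c ->
  integral_value f m -> integral_value (fun x => c * f x) (c * m).
Proof.
move=> c0 [mf f0 fm]; split.
- exact: measurable_funM.
- by move=> x Dx; rewrite mulr_ge0 ?f0.
under eq_integral do rewrite EFinM.
rewrite ge0_integralZl ?lee_fin//; first by rewrite fm EFinM.
- by apply/measurable_EFinP.
Qed.

Lemma integral_valueD (f g : T -> R) (m n : R) :
  integral_value f m -> integral_value g n ->
  integral_value (fun x => f x + g x) (m + n).
Proof.
move=> [mf f0 fm] [mg g0 gn]; split.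
- exact: measurable_funD.
- by move=> x Dx; rewrite addr_ge0 ?f0 ?g0.
under eq_integral do rewrite EFinD.
rewrite ge0_integralD// ?fm ?gn//.
- by apply/measurable_EFinP.
- by apply/measurable_EFinP.
Qed.

(** Nonnegativity keeps every integral finite, so that the value for f can be
recovered by subtraction; this replaces integration of signed functions. *)
Lemma integral_value_subr (f g h : T -> R) (m n : R) :
  (forall x, f x + g x = h x) -> measurable_fun D f ->
  (forall x, D x -> 0 <= f x) ->
  integral_value h m -> integral_value g n -> integral_value f (m - n).
Proof.
move=> fgh mf f0 [mh h0 hm] [mg g0 gn]; split => //.
have : (\int[mu]_(x in D) (f x)%:E + \int[mu]_(x in D) (g x)%:E = m%:E)%E.
  rewrite -ge0_integralD//.
  - by rewrite -hm; apply: eq_integral => x _; rewrite -EFinD fgh.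
  - by apply/measurable_EFinP.
  - by apply/measurable_EFinP.
rewrite gn; case: (\int[mu]_(x in D) (f x)%:E)%E => [r| |]//= -[<-].
by rewrite addrK.
Qed.

Lemma integral_value_indic (A : set T) (m : R) : measurable A -> A `<=` D ->
  mu A = m%:E -> integral_value (\1_A) m.
Proof.
move=> mA AD Am; split => //.
by rewrite integral_indic// (setIidl AD).
Qed.

Lemma integral_value_cst (c m : R) : 0 <= c -> mu D = m%:E ->
  integral_value (fun=> c) (c * m).
Proof. by move=> c0 Dm; split => //; rewrite integral_cst//= Dm. Qed.

Lemma eq_integral_value (f g : T -> R) (m n : R) : f =1 g -> m = n ->
  integral_value f m -> integral_value g n.
Proof. by move=> /funext -> ->. Qed.

(** The sum of the f j has a finite integral, so it is finite almost everywhere and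
its terms tend to 0. *)
Lemma ae_cvg0_of_summable (f : nat -> T -> R) (m : nat -> R) (B : R) :
  (forall j, integral_value (f j) (m j)) ->
  (forall n, \sum_(0 <= j < n) m j <= B) ->
  {ae mu, forall x, D x -> f ^~ x @ \oo --> (0 : R)}.
Proof.
move=> fm mB.
have f0 j x : D x -> 0 <= f j x by move=> Dx; have [_ + _] := fm j; apply.
have mf j : measurable_fun D (f j) by have [] := fm j.
pose F x : \bar R := (\sum_(0 <= j <oo) (f j x)%:E)%E.
have mF : measurable_fun D F.
  by apply: ge0_emeasurable_sum => [j x Dx _|j _];
    [rewrite lee_fin f0|apply/measurable_EFinP].
have F0 x : D x -> (0 <= F x)%E.
  by move=> Dx; apply: nneseries_ge0 => j _ _; rewrite lee_fin f0.
have iF : (\int[mu]_(x in D) F x <= B%:E)%E.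
  rewrite integral_nneseries//.
  - apply: lime_le.
      apply: is_cvg_nneseries => j _ _; apply: integral_ge0 => x Dx.
      by rewrite lee_fin f0.
    apply: nearW => n /=.
    rewrite (eq_bigr (fun j => (m j)%:E)); last by move=> j _; have [] := fm j.
    by rewrite sumEFin lee_fin.
  - by move=> j; apply/measurable_EFinP.
have intF : mu.-integrable D F.
  apply/integrableP; split => //.
  rewrite (eq_integral F); first exact: le_lt_trans iF (ltry _).
  by move=> x /set_mem Dx; rewrite gee0_abs ?F0.
have H := integrable_ae mD intF.
apply: filterS H => x Fx Dx.
apply: cvg_series_cvg_0; apply: nondecreasing_is_cvgn.
  apply/nondecreasing_seqP => n; rewrite /series/= big_nat_recr//= lerDl.
  exact: f0.
exists (fine (F x)) => _ [n _ <-]; rewrite -lee_fin fineK ?Fx//.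
rewrite /series/= -sumEFin; apply: nneseries_lim_ge => j _ _.
by rewrite lee_fin f0.
Qed.

End integral_value.

(** * Logarithmic growth of the harmonic sum *)

Lemma ln_le_harmonic_sum (R : realType) (N : nat) : (0 < N)%N -> ln N%:R <= harmonic_sum R N.
Proof.
elim: N => // -[_ _|N IH _]; first by rewrite ln1 harmonic_sum_ge0.
rewrite /harmonic_sum big_nat_recr//= -/(harmonic_sum R N.+1).
have w0 : 0 < N.+1%:R :> R by rewrite ltr0n.
rewrite -[N.+2%:R]natr1; apply: le_trans (lerD (IH isT) (lexx _)).
rewrite (_ : N.+1%:R + 1 = N.+1%:R * (1 + N.+1%:R^-1)); last first.
  by field; rewrite gt_eqF.
rewrite lnM ?posrE ?addr_gt0 ?invr_gt0// lerD2l le_ln1Dx//.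
by apply: lt_le_trans (_ : 0 <= _); rewrite ?ltrN10// invr_ge0.
Qed.

Lemma harmonic_sum_le_ln (R : realType) (N : nat) : harmonic_sum R N.+2 <= 1 + ln N.+1%:R.
Proof.
elim: N => [|N IH]; first by rewrite /harmonic_sum big_nat1 invr1 ln1 addr0.
rewrite /harmonic_sum big_nat_recr//= -/(harmonic_sum R N.+2).
apply: le_trans (lerD IH (lexx _)) _; rewrite -addrA lerD2l.
have w0 : 0 < N.+1%:R :> R by rewrite ltr0n.
rewrite -[N.+2%:R]natr1; set w := N.+1%:R in w0 *.
have w1 : 0 < w + 1 by rewrite addr_gt0.
rewrite (_ : w = (w + 1) * (1 - (w + 1)^-1)); last by field; rewrite gt_eqF.
have i1 : (w + 1)^-1 < 1 by rewrite invf_lt1// ltrDr.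
rewrite lnM ?posrE// ?subr_gt0// (_ : (w + 1) * _ + 1 = w + 1); last first.
  by field; rewrite gt_eqF.
rewrite -addrA gerDl.
have := @le_ln1Dx R (- (w + 1)^-1); rewrite ltrN2 => /(_ i1) h.
by rewrite addrC -lerBrDl sub0r in h *.
Qed.

Lemma harmonic_sum_unbounded (R : realType) (t : R) : exists N, t <= harmonic_sum R N.
Proof.
exists (Num.truncn (expR t)).+1; apply: le_trans (ln_le_harmonic_sum _ _) => //.
by rewrite -[leLHS]expRK ler_ln ?posrE ?expR_gt0// ltW// truncnS_gt.
Qed.

Lemma harmonic_sum_nondecreasing (R : realType) : {homo harmonic_sum R : N M / (N <= M)%N >-> N <= M}.
Proof.
apply/nondecreasing_seqP => -[|N]; first by rewrite /harmonic_sum !big_geq.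
by rewrite /harmonic_sum [leRHS]big_nat_recr//= lerDl invr_ge0.
Qed.

(** The first N at which the sum reaches t overshoots by at most one term. *)
Lemma harmonic_sum_near (R : realType) (t : R) : 0 < t ->
  exists N, t <= harmonic_sum R N <= t + 1.
Proof.
move=> t0; case: (ex_minnP (harmonic_sum_unbounded t)) => N tN minN.
exists N; rewrite tN/=.
case: N => [|[|N]] in tN minN *.
- by move: tN; rewrite /harmonic_sum big_geq// leNgt t0.
- by move: tN; rewrite /harmonic_sum big_geq// leNgt t0.
have := contra (minN N.+1); rewrite -ltnNge ltnSn => /(_ isT); rewrite -ltNge => h.
rewrite /harmonic_sum big_nat_recr//= -/(harmonic_sum R N.+1) lerD ?(ltW h)//.
by rewrite invf_le1// ler1n.
Qed.

(** * The variance of the counting function *)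

Section almost_everywhere.
Variables (R : realType) (k : nat).
Hypothesis k0 : (0 < k)%N.
Local Notation T := (k.-tuple (measurableTypeR R)).
Local Notation mu := (lebesgue_Rn R k).

Definition cube (L : nat) : set T :=
  [set x | forall i, `[- L%:R, L%:R]%classic (tnth x i : R)].

Lemma measurable_cube L : measurable (cube L).
Proof.
apply: (@measurable_rect R k (fun=> `[- L%:R, L%:R]%classic)) => i.
exact: measurable_itv.
Qed.

Lemma lebesgue_cube L : mu (cube L) = ((2 * L)%:R ^+ k)%:E.
Proof.
have mI (i : 'I_k) : measurable (`[- L%:R, L%:R]%classic : set (measurableTypeR R)).
  exact: measurable_itv.
rewrite [LHS](power_measure_rect _ mI).
rewrite (eq_bigr (fun=> ((2 * L)%:R : R)%:E)); last first.
  move=> i _; rewrite [LHS](lebesgue_measure_itv `[- L%:R, L%:R]%R)/= lte_fin.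
  case: ltrP => h; first by rewrite -EFinD opprK natrM mulr_natl mulr2n.
  have Lp : 0 <= L%:R :> R by [].
  have L0 : L%:R = 0 :> R by lra.
  by rewrite natrM L0 mulr0.
by rewrite prodEFin prodr_const card_ord.
Qed.

Variables a b : 'I_k -> R.
Hypotheses (a0 : forall i, -2 <= a i <= 0) (b0 : forall i, 0 <= b i <= 2).
Local Notation vol := (vol a b).
Local Notation ov := (overlap_box a b).
Local Notation H := (harmonic_sum R).

Definition hits (L N : nat) (x : T) : R :=
  \sum_(1 <= n < N) \sum_(p : numers k L n) \1_(box a b p) x.

(** The part of the count that has a small second moment. *)
Definition good_hits (K L N : nat) (x : T) : R :=
  \sum_(1 <= n < N) \sum_(p : numers k L n) (common_divisor p <= K)%N%:R * \1_(box a b p) x.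

Definition bad_hits (K L N : nat) (x : T) : R :=
  \sum_(1 <= n < N) \sum_(p : numers k L n) (K < common_divisor p)%N%:R * \1_(box a b p) x.

Lemma good_bad_hits K L N x : good_hits K L N x + bad_hits K L N x = hits L N x.
Proof.
rewrite -big_split/=; apply: eq_bigr => n _; rewrite -big_split/=.
apply: eq_bigr => p _; rewrite -mulrDl -natrD.
by case: leqP => _; rewrite ?addn0 ?add0n mul1r.
Qed.

Lemma box_sub_cube L n (p : numers k L n) : box a b p `<=` cube L.
Proof.
move=> x xp i; have := xp i; rewrite /= !in_itv/= /endpoint => /andP[h1 h2].
have n0 : (0 < n)%N.
  by case: n p xp h1 h2 => // p _; rewrite invr0 !mulr0 => /le_lt_trans h /h; rewrite ltxx.
have nR : 0 < n%:R :> R by rewrite ltr0n.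
have r0 := tolerance_ge0 R k n; have r1 := tolerance_le1 R k n0.
have pn := ltn_ord (p i).
move: h1 h2; rewrite ler_pdivrMr// ltr_pdivlMr// => h1 h2.
have /andP[a1 a2] := a0 i; have /andP[b1 b2] := b0 i.
have ar : -2 <= a i * tolerance R k n.
  have : 0 <= - a i * (1 - tolerance R k n) by rewrite mulr_ge0//; lra.
  lra.
have br : b i * tolerance R k n <= 2.
  have : 0 <= b i * (1 - tolerance R k n) by rewrite mulr_ge0//; lra.
  lra.
have nE : (numer L n (p i))%:~R = (p i : nat)%:R - (L * n - 2)%:R :> R.
  by rewrite /numer intrB.
have Ln2 : (2 <= L * n)%N.
  by have := leq_ltn_trans (leq0n _) pn; rewrite muln_gt0 subn_gt0 /= => /ltnW.
have cE : (L * n - 2)%:R + 2 = (L * n)%:R :> R by rewrite -natrD subnK.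
have p0 : 0 <= (p i : nat)%:R :> R by [].
have p1 : (p i : nat)%:R + 1 <= 2 * (L * n - 2)%:R :> R.
  by rewrite natr1 -natrM ler_nat.
have lo : - (L * n)%:R + 2 <= (numer L n (p i))%:~R :> R by rewrite nE -cE; lra.
have hi : (numer L n (p i))%:~R + 2 <= (L * n)%:R :> R by rewrite nE -cE; lra.
rewrite natrM in lo hi; apply/andP; split.
  by rewrite -(ler_pM2r nR); lra.
by rewrite -(ler_pM2r nR); lra.
Qed.

Local Notation intQ L := (integral_value mu (cube L)).

Lemma integral_boxI L n m (p : numers k L n) (q : numers k L m) :
  intQ L (fun x => \1_(box a b p) x * \1_(box a b q) x) (ov p q).
Proof.
have -> : (fun x => \1_(box a b p) x * \1_(box a b q) x) =
    (\1_(box a b p `&` box a b q) : T -> R) by rewrite indicI.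
apply: integral_value_indic.
- exact: measurable_cube.
- by apply: measurableI; exact: measurable_box.
- by move=> x [xp _]; exact: box_sub_cube xp.
- exact: lebesgue_boxI.
Qed.

Lemma integral_box L n (p : numers k L n) : intQ L (\1_(box a b p)) (ov p p).
Proof.
apply: eq_integral_value (integral_boxI p p) => // x.
by rewrite indicE -natrM mulnb andbb.
Qed.

Lemma integral_good_hits K L N : intQ L (good_hits K L N)
  (\sum_(1 <= n < N) \sum_(p : numers k L n) (common_divisor p <= K)%N%:R * ov p p).
Proof.
have mQ := measurable_cube L.
do 2!(apply: integral_value_sum => // ?); apply: integral_valueZ => //.
exact: integral_box.
Qed.

Lemma integral_bad_hits K L N : intQ L (bad_hits K L N)
  (\sum_(1 <= n < N) \sum_(p : numers k L n) (K < common_divisor p)%N%:R * ov p p).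
Proof.
have mQ := measurable_cube L.
do 2!(apply: integral_value_sum => // ?); apply: integral_valueZ => //.
exact: integral_box.
Qed.

Lemma integral_good_hits_sqr K L N : intQ L (fun x => good_hits K L N x ^+ 2)
  (\sum_(1 <= n < N) \sum_(1 <= m < N) \sum_(p : numers k L n) \sum_(q : numers k L m)
      ((common_divisor p <= K)%N && (common_divisor q <= K)%N)%:R * ov p q).
Proof.
have mQ := measurable_cube L.
apply: (@eq_integral_value _ _ _ _ _ (fun x => \sum_(1 <= n < N)
   \sum_(1 <= m < N) \sum_(p : numers k L n) \sum_(q : numers k L m)
      ((common_divisor p <= K)%N && (common_divisor q <= K)%N)%:R *
       (\1_(box a b p) x * \1_(box a b q) x))) => //; last first.
  do 4!(apply: integral_value_sum => // ?); apply: integral_valueZ => //.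
  exact: integral_boxI.
move=> x; rewrite expr2 /good_hits mulr_suml; apply: eq_bigr => n _.
rewrite mulr_sumr; apply: eq_bigr => m _.
rewrite mulr_suml; apply: eq_bigr => p _.
rewrite mulr_sumr; apply: eq_bigr => q _.
by rewrite -mulnb natrM; ring.
Qed.

(** Expanding the square, the main terms of the second moment, of the mean and of
the constant cancel.  The term K H comes from equal or partly equal fractions and from
the margin, the term H^2 / K from the pairs with a large common divisor. *)
Lemma variance_le L : (0 < L)%N -> exists2 C : R, 0 <= C &
  forall K N, (0 < K)%N -> exists2 v : R,
    intQ L (fun x => (good_hits K L N x - vol * H N) ^+ 2) v &
    v <= C * (K%:R * H N + H N ^+ 2 / K%:R).
Proof.
move=> L0; have [C C0 HC] := second_moment_le k0 a0 b0 L.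
have v0 : 0 <= vol by exact: vol_ge0.
set W : R := (2 * L)%:R ^+ k in HC *; have W0 : 0 <= W by rewrite exprn_ge0.
exists (C + 8 * W * vol ^+ 2 * k%:R + 2 * W * vol ^+ 2).
  by rewrite !(mulr_ge0, addr_ge0) ?exprn_ge0.
move=> K N K0; have KR : 1 <= K%:R :> R by rewrite ler1n.
have h0 := harmonic_sum_ge0 R N.
have mQ := measurable_cube L.
set M := vol * H N; have M0 : 0 <= M by rewrite mulr_ge0.
set m2 := \sum_(1 <= n < N) \sum_(1 <= m < N) \sum_(p : numers k L n)
  \sum_(q : numers k L m) ((common_divisor p <= K)%N && (common_divisor q <= K)%N)%:R * ov p q.
set m1 := \sum_(1 <= n < N) \sum_(p : numers k L n) (common_divisor p <= K)%N%:R * ov p p.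
exists (m2 + M ^+ 2 * W - 2 * M * m1).
  apply: (@integral_value_subr _ _ _ _ _ mQ _ (fun x => 2 * M * good_hits K L N x)
    (fun x => good_hits K L N x ^+ 2 + M ^+ 2)).
  - by move=> x; ring.
  - apply: measurable_funX; apply: measurable_funB => //.
    by have [] := integral_good_hits K L N.
  - by move=> x _; exact: sqr_ge0.
  - apply: integral_valueD => //; first exact: integral_good_hits_sqr.
    by apply: integral_value_cst; [|exact: sqr_ge0|exact: lebesgue_cube].
  - by apply: integral_valueZ; rewrite ?mulr_ge0//; exact: integral_good_hits.
have h2 : m2 <= W * vol ^+ 2 * H N ^+ 2 + C * K%:R * H N by exact: HC.
have h1 : W * vol * (H N - 4 * k%:R) - W * vol * H N / K%:R <= m1.
  rewrite lerBlDr; apply: le_trans (mean_ge k0 a0 b0 N L0) _.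
  apply: le_trans (lerD (lexx m1) (bad_mean_le k0 a0 b0 L N K0)).
  rewrite -big_split/=; apply: ler_sum => n _; rewrite -big_split/=.
  apply: ler_sum => p _; rewrite -mulrDl -natrD.
  by case: leqP => _; rewrite ?addn0 ?add0n mul1r.
have M20 : 0 <= 2 * M by rewrite mulr_ge0.
have := ler_wpM2l M20 h1; rewrite /M => {}h1.
apply: le_trans (_ : W * vol ^+ 2 * H N ^+ 2 + C * K%:R * H N + (vol * H N) ^+ 2 * W -
   2 * (vol * H N) * (W * vol * (H N - 4 * k%:R) - W * vol * H N / K%:R) <= _).
  by rewrite lerB// lerD2r.
have KH : H N <= K%:R * H N by rewrite ler_peMl.
have c1 : 0 <= W * vol ^+ 2 * k%:R * (K%:R * H N - H N).
  by rewrite !mulr_ge0 ?exprn_ge0 ?subr_ge0.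
have c2 : 0 <= C * (H N ^+ 2 / K%:R) by rewrite !mulr_ge0 ?exprn_ge0 ?invr_ge0.
have c3 : 0 <= W * vol ^+ 2 * k%:R * (H N ^+ 2 / K%:R).
  by rewrite !mulr_ge0 ?exprn_ge0 ?invr_ge0.
have c4 : 0 <= W * vol ^+ 2 * (K%:R * H N) by rewrite !mulr_ge0 ?exprn_ge0.
rewrite -subr_ge0.
rewrite (_ : _ - _ = 8 * (W * vol ^+ 2 * k%:R * (K%:R * H N - H N)) +
  C * (H N ^+ 2 / K%:R) + 8 * (W * vol ^+ 2 * k%:R * (H N ^+ 2 / K%:R)) +
  2 * (W * vol ^+ 2 * (K%:R * H N))); last by ring.
by rewrite !addr_ge0// mulr_ge0.
Qed.

End almost_everywhere.

(** * Almost everywhere asymptotics for boxes *)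

Lemma cvg0_sqr (R : realType) (y : nat -> R) :
  (fun j => y j ^+ 2) @ \oo --> (0 : R) -> y @ \oo --> (0 : R).
Proof.
move=> y2; apply/cvgr0Pnorm_lt => e e0.
have e20 : 0 < e ^+ 2 by rewrite exprn_gt0.
move/cvgr0Pnorm_lt : y2 => /(_ _ e20); apply: filterS => j.
by rewrite normrX ltr_sqr ?nnegrE// ltW.
Qed.

Lemma sparse_ratio_cvg (R : realType) :
  (fun j : nat => (j.+2%:R ^+ 4 + 1) / j.+1%:R ^+ 4 : R) @ \oo --> (1 : R).
Proof.
rewrite (_ : (fun j : nat => _) =
   (fun j => (1 + harmonic j) ^+ 4 + harmonic j ^+ 4 : R)); last first.
  apply/funext => j; rewrite /harmonic/= -[j.+2%:R]natr1.
  have w0 : 0 < j.+1%:R :> R by rewrite ltr0n.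
  by field; rewrite gt_eqF.
have h0 := @cvg_harmonic R.
have hX (u : nat -> R) (l : R) : u @ \oo --> l -> (fun j => u j ^+ 4) @ \oo --> l ^+ 4.
  move=> ul; rewrite !exprS expr0 mulr1.
  under eq_fun do rewrite !exprS expr0 mulr1.
  by do 3!(apply: cvgM => //).
rewrite -[X in _ --> X]addr0 -[X in _ --> X + _](expr1n _ 4) -[X in _ --> _ + X](expr0n R 4).
apply: cvgD; last exact: hX.
apply: hX; rewrite -[X in _ --> X]addr0; apply: cvgD => //; exact: cvg_cst.
Qed.

(** Between two consecutive N_j, monotonicity of u and h bounds u / h in terms of
its values at N_j and N_(j+1), up to the ratio of (j+2)^4 + 1 to (j+1)^4. *)
Lemma cvg_of_sparse (R : realType) (u h : nat -> R) (Nj : nat -> nat) (l : R) :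
  {homo u : n m / (n <= m)%N >-> n <= m} -> {homo h : n m / (n <= m)%N >-> n <= m} ->
  (forall n, 0 <= u n) ->
  (forall j, j.+1%:R ^+ 4 <= h (Nj j) <= j.+1%:R ^+ 4 + 1) ->
  (fun j => u (Nj j) / h (Nj j)) @ \oo --> l ->
  (fun n => u n / h n) @ \oo --> l.
Proof.
move=> umono hmono u0 hN vl; pose v j := u (Nj j) / h (Nj j).
pose rho j : R := (j.+2%:R ^+ 4 + 1) / j.+1%:R ^+ 4.
have p0 j : 0 < j.+1%:R ^+ 4 :> R by rewrite exprn_gt0// ltr0n.
have h0 j : 0 < h (Nj j) by have /andP[+ _] := hN j; exact: lt_le_trans.
have rho0 j : 0 < rho j by rewrite divr_gt0// addr_gt0// p0.
have v0 j : 0 <= v j by rewrite divr_ge0// ltW.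
have vE j : u (Nj j) = v j * h (Nj j) by rewrite /v divfK// gt_eqF.
have rl : rho @ \oo --> (1 : R) by exact: sparse_ratio_cvg.
have Ul : (fun j => v j.+1 * rho j) @ \oo --> l.
  by rewrite -[X in _ --> X]mulr1; apply: cvgM => //; rewrite cvg_shiftS.
have Ll : (fun j => v j / rho j) @ \oo --> l.
  by have := cvgM vl (cvgV (oner_neq0 R) rl); rewrite invr1 mulr1; apply.
apply/cvgrPdist_lt => e e0.
move/cvgrPdist_lt : Ul => /(_ _ e0) [J1 _ HJ1].
move/cvgrPdist_lt : Ll => /(_ _ e0) [J2 _ HJ2].
pose J := maxn J1 J2.
exists (Nj J) => // n /= Jn.
have exP : exists j, (Nj j <= n)%N by exists J.
have bound j : (Nj j <= n)%N -> (j <= Num.truncn (h n))%N.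
  move=> jn; rewrite truncn_ge_nat; last first.
    exact: le_trans (ltW (h0 _)) (hmono _ _ jn).
  apply: le_trans (hmono _ _ jn).
  have /andP[+ _] := hN j; apply: le_trans.
  rewrite -natrX ler_nat; apply: leq_trans (leqnSn j) _.
  by rewrite -[leqLHS]expn1 leq_pexp2l.
(* j is the last index with N_j <= n *)
have [j jn jmax] := ex_maxnP exP bound.
have Jj : (J <= j)%N by exact: jmax.
have nj : (n < Nj j.+1)%N.
  by rewrite ltnNge; apply/negP => /jmax; rewrite ltnn.
have hn : j.+1%:R ^+ 4 <= h n.
  by have /andP[+ _] := hN j; move=> /le_trans; apply; exact: hmono.
have hn0 : 0 < h n by exact: lt_le_trans hn.
have hn' : h n <= j.+2%:R ^+ 4 + 1.
  by have /andP[_] := hN j.+1; apply: le_trans; exact/hmono/ltnW.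
have up : u n / h n <= v j.+1 * rho j.
  rewrite ler_pdivrMr//; apply: le_trans (umono _ _ (ltnW nj)) _.
  rewrite vE -(mulrA (v _)) ler_wpM2l//; have /andP[_] := hN j.+1; move=> /le_trans; apply.
  rewrite /rho -(mulrA (_ + 1)) ler_peMr ?addr_ge0 ?exprn_ge0//.
  by rewrite mulrC ler_pdivlMr ?mul1r.
have lo : v j / rho j <= u n / h n.
  rewrite ler_pdivlMr//; apply: le_trans (umono _ _ jn).
  rewrite vE -(mulrA (v _)) ler_wpM2l// mulrC ler_pdivrMr//.
  apply: le_trans hn' _; have /andP[hj _] := hN j.
  rewrite (_ : _ * rho j = (j.+2%:R ^+ 4 + 1) * (h (Nj j) / j.+1%:R ^+ 4)).
    by rewrite ler_peMr ?addr_ge0 ?exprn_ge0// ler_pdivlMr// mul1r.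
  by rewrite /rho; ring.
have d1 := HJ1 j (leq_trans (leq_maxl _ _) Jj).
have d2 := HJ2 j (leq_trans (leq_maxr _ _) Jj).
move: d1 d2; rewrite /= !ltr_norml => /andP[d1 d1'] /andP[d2 d2'].
by apply/andP; split; lra.
Qed.

Section ae_limit.
Variables (R : realType) (k : nat) (a b : 'I_k -> R).
Hypotheses (k0 : (0 < k)%N) (a0 : forall i, -2 <= a i <= 0)
  (b0 : forall i, 0 <= b i <= 2).
Local Notation T := (k.-tuple (measurableTypeR R)).
Local Notation mu := (lebesgue_Rn R k).
Local Notation H := (harmonic_sum R).

Lemma hits_nondecreasing L x : {homo (hits a b L) ^~ x : N M / (N <= M)%N >-> N <= M}.
Proof.
apply/nondecreasing_seqP => -[|N]; first by rewrite /hits !big_geq.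
rewrite /hits [leRHS]big_nat_recr//= lerDl; exact: sumr_ge0.
Qed.

(** With H (N_j) close to (j+1)^4 and K_j = (j+1)^2, the normalized variance and the
normalized mean of the bad part are both O(1 / (j+1)^2). *)
Lemma ae_hits_cvg L : (0 < L)%N ->
  {ae mu, forall x : T, cube L x ->
    hits a b L N x / H N @[N --> \oo] --> vol a b}.
Proof.
move=> L0; have [C C0 HC] := variance_le k0 a0 b0 L0.
have vol0 : 0 <= vol a b by exact: vol_ge0.
set W : R := (2 * L)%:R ^+ k; have W0 : 0 <= W by rewrite exprn_ge0.
have t0 j : 0 < j.+1%:R ^+ 4 :> R by rewrite exprn_gt0// ltr0n.
have [Nj NjP] := choice (fun j => harmonic_sum_near (t0 j)).
pose K j := (j.+1 ^ 2)%N; have K0 j : (0 < K j)%N by rewrite expn_gt0.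
have HN0 j : 0 < H (Nj j) by have /andP[+ _] := NjP j; exact: lt_le_trans.
have [v vP] := choice (fun j =>
  let: ex_intro2 v h1 h2 := HC (K j) (Nj j) (K0 j) in ex_intro _ v (conj h1 h2)).
have mQ := @measurable_cube R k L.
pose bm j := \sum_(1 <= n < Nj j) \sum_(p : numers k L n)
   (K j < common_divisor p)%N%:R * overlap_box a b p p.
pose f j x := (H (Nj j) ^- 2) * (good_hits a b (K j) L (Nj j) x - vol a b * H (Nj j)) ^+ 2 +
   (H (Nj j))^-1 * bad_hits a b (K j) L (Nj j) x.
have fm j : integral_value mu (cube L) (f j)
    (H (Nj j) ^- 2 * v j + (H (Nj j))^-1 * bm j).
  apply: integral_valueD => //; apply: integral_valueZ => //.
  - by rewrite invr_ge0 exprn_ge0// ltW.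
  - by have [] := vP j.
  - by rewrite invr_ge0 ltW.
  - exact: integral_bad_hits.
have fle j : H (Nj j) ^- 2 * v j + (H (Nj j))^-1 * bm j <=
   (2 * C + W * vol a b) * (j.+1%:R ^+ 2)^-1.
  have [_ vle] := vP j; have ble := bad_mean_le k0 a0 b0 L (Nj j) (K0 j).
  have /andP[Hge _] := NjP j; have Hp := HN0 j.
  set h := H (Nj j) in Hge Hp vle ble *.
  have s0 : 0 < j.+1%:R ^+ 2 :> R by rewrite exprn_gt0// ltr0n.
  rewrite /K natrX in vle ble; set s : R := j.+1%:R ^+ 2 in s0 vle ble *.
  have sh : s ^+ 2 <= h by rewrite /s -exprM.
  have e1 : h ^- 2 * v j <= C * (s / h + s^-1).
    rewrite mulrC ler_pdivrMr ?exprn_gt0//; apply: le_trans vle _.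
    by rewrite le_eqVlt; apply/orP; left; apply/eqP; field; rewrite !gt_eqF.
  have e2 : h^-1 * bm j <= W * vol a b * s^-1.
    rewrite mulrC ler_pdivrMr//; apply: le_trans ble _.
    by rewrite le_eqVlt; apply/orP; left; apply/eqP; rewrite /W; field; rewrite gt_eqF.
  have e3 : s / h <= s^-1.
    by rewrite ler_pdivrMr// mulrC ler_pdivlMr// -expr2.
  apply: le_trans (lerD e1 e2) _.
  have := ler_wpM2l C0 e3; lra.
have := @ae_cvg0_of_summable _ _ _ mu _ mQ f _ ((2 * C + W * vol a b) * 2) fm.
have CW : 0 <= 2 * C + W * vol a b by rewrite addr_ge0 ?mulr_ge0.
have sum2 n : \sum_(0 <= j < n) (j.+1%:R ^+ 2)^-1 <= 2 :> R.
  case: n => [|n]; first by rewrite big_geq.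
  rewrite big_nat_recl//= expr1n invr1.
  have := @sum_inv_sqr_le R 1 n.+2 isT; rewrite invr1.
  rewrite -(addn2 n) -{1}[2%N]add0n big_addn addnK.
  under eq_bigr do rewrite addn2.
  lra.
have bnd n : \sum_(0 <= j < n) (H (Nj j) ^- 2 * v j + (H (Nj j))^-1 * bm j) <=
    (2 * C + W * vol a b) * 2.
  apply: le_trans (ler_wpM2l CW (sum2 n)); rewrite mulr_sumr.
  by apply: ler_sum => j _; exact: fle.
move=> /(_ bnd); apply: filterS => x fx Qx.
have {}fx := fx Qx.
apply: (@cvg_of_sparse R _ _ Nj) => //.
- exact: hits_nondecreasing.
- exact: harmonic_sum_nondecreasing.
- by move=> n; apply: sumr_ge0 => m _; apply: sumr_ge0.
have B0 j : 0 <= (H (Nj j))^-1 * bad_hits a b (K j) L (Nj j) x.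
  rewrite mulr_ge0 ?invr_ge0 ?(ltW (HN0 j))// sumr_ge0// => n _.
  by rewrite sumr_ge0// => p _; rewrite mulr_ge0.
have G0 j : 0 <= (H (Nj j) ^- 2) * (good_hits a b (K j) L (Nj j) x - vol a b * H (Nj j)) ^+ 2.
  by rewrite mulr_ge0 ?sqr_ge0// invr_ge0 exprn_ge0// ltW.
have cB : (fun j => (H (Nj j))^-1 * bad_hits a b (K j) L (Nj j) x) @ \oo --> (0 : R).
  apply: (@squeeze_cvgr _ _ _ _ (fun=> 0) (fun j => f j x)) => //.
  2: exact: cvg_cst.
  by apply: nearW => j; rewrite B0/= /f lerDr.
have cG : (fun j => good_hits a b (K j) L (Nj j) x / H (Nj j) - vol a b) @ \oo --> (0 : R).
  apply: cvg0_sqr; apply: (@squeeze_cvgr _ _ _ _ (fun=> 0) (fun j => f j x)) => //.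
  2: exact: cvg_cst.
  apply: nearW => j; rewrite sqr_ge0/= /f.
  rewrite (_ : _ ^+ 2 = (H (Nj j) ^- 2) *
     (good_hits a b (K j) L (Nj j) x - vol a b * H (Nj j)) ^+ 2) ?lerDl//.
  by field; rewrite gt_eqF.
rewrite (_ : (fun j => _) = (fun j =>
    (good_hits a b (K j) L (Nj j) x / H (Nj j) - vol a b) +
    (H (Nj j))^-1 * bad_hits a b (K j) L (Nj j) x + vol a b)); last first.
  by apply/funext => j; rewrite -(good_bad_hits a b (K j)); ring.
rewrite -[X in _ --> X]add0r; apply: cvgD; last exact: cvg_cst.
by rewrite -[X in _ --> X]add0r; apply: cvgD.
Qed.

End ae_limit.

(** * Inner and outer grid approximation of the unit ball *)

Section ball.
Variables (R : realType) (k : nat).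
Hypothesis k0 : (0 < k)%N.
Local Notation T := (k.-tuple (measurableTypeR R)).
Local Notation mu := (lebesgue_Rn R k).
Local Notation H := (harmonic_sum R).

(** An interval of length t with one end at 0; s is true on the negative side. *)
Definition half_segment (s : bool) (t z : R) : bool :=
  if s then - t <= z < 0 else 0 <= z < t.

(** The grid interval of length 1 / M number c.2, counted away from 0 on the side
given by c.1. *)
Definition cell1 (M : nat) (c : bool * nat) (z : R) : bool :=
  if c.1 then - (c.2.+1%:R / M%:R) <= z < - (c.2%:R / M%:R)
  else c.2%:R / M%:R <= z < c.2.+1%:R / M%:R.

Lemma cell1E M s j z : (0 < M)%N ->
  (cell1 M (s, j) z)%:R =
  (half_segment s (j.+1%:R / M%:R) z)%:R - (half_segment s (j%:R / M%:R) z)%:R :> R.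
Proof.
move=> M0; have MR : 0 < M%:R :> R by rewrite ltr0n.
have j0 : 0 <= j%:R / M%:R :> R by rewrite divr_ge0// ltW.
have jj : j%:R / M%:R < j.+1%:R / M%:R :> R.
  by rewrite ltr_pM2r ?invr_gt0// ltr_nat.
rewrite /cell1 /half_segment /=; move: (j%:R / M%:R) (j.+1%:R / M%:R) j0 jj => u v u0 uv.
case: s.
  case: (leP (- v) z) => h1; case: (ltP z (- u)) => h2; case: (leP (- u) z) => h3;
   case: (ltP z 0) => h4 //=; rewrite ?subr0 ?subrr//; lra.
case: (leP u z) => h1; case: (ltP z v) => h2; case: (leP 0 z) => h3;
   case: (ltP z u) => h4 //=; rewrite ?subr0 ?subrr//; lra.
Qed.

Lemma cell1_inj M c c' z : (0 < M)%N -> cell1 M c z -> cell1 M c' z -> c = c'.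
Proof.
move=> M0; have MR : 0 < M%:R :> R by rewrite ltr0n.
case: c c' => [s j] [s' j']; rewrite /cell1/=.
have p0 (i : nat) : 0 <= i%:R / M%:R :> R by rewrite divr_ge0// ltW.
have aux (i l : nat) (w : R) : i%:R / M%:R <= w -> w < l.+1%:R / M%:R -> (i <= l)%N.
  rewrite ler_pdivrMr// ltr_pdivlMr// => h1 h2.
  by rewrite -ltnS -(ltr_nat R); exact: le_lt_trans h2.
have aux' (i l : nat) (w : R) : i%:R / M%:R < w -> w <= l.+1%:R / M%:R -> (i <= l)%N.
  rewrite ltr_pdivrMr// ler_pdivlMr// => h1 h2.
  by rewrite -ltnS -(ltr_nat R); exact: lt_le_trans h2.
case: s; case: s' => /andP[h1 h2] /andP[h3 h4].
- congr pair; apply/eqP; rewrite eqn_leq.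
  by rewrite (aux' j j' (- z)) ?(aux' j' j (- z))//; lra.
- by exfalso; have := p0 j; have := p0 j'; lra.
- by exfalso; have := p0 j; have := p0 j'; lra.
- congr pair; apply/eqP; rewrite eqn_leq.
  by rewrite (aux j j' z) ?(aux j' j z).
Qed.

Lemma cell1_ex M z : (0 < M)%N -> `|z| <= 1 ->
  exists2 c : bool * 'I_M.+1, cell1 M (c.1, nat_of_ord c.2) z &
    (c.2 : nat)%:R / M%:R <= `|z|.
Proof.
move=> M0; have MR : 0 < M%:R :> R by rewrite ltr0n.
rewrite ler_norml => /andP[z1 z2].
have /andP[f1 f2] := floor_itv (M%:R * z).
set w := Num.floor (M%:R * z) in f1 f2.
have wM : w <= M%:Z.
  by rewrite -(ler_int R) -pmulrn; apply: le_trans f1 _; rewrite ler_piMr// ltW.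
have wM' : - M%:Z <= w.
  rewrite floor_ge_int rmorphN/= -pmulrn.
  by rewrite -[leLHS]mulr1 mulNr -mulrN ler_pM2l.
have [w0|w0] := lerP 0 w.
  have jM : (`|w| < M.+1)%N by lia.
  have wE : w = `|w|%:Z by lia.
  have z0 : 0 <= z.
    by rewrite -(pmulr_rge0 _ MR); apply: le_trans f1; rewrite ler0z.
  have wR : w%:~R = `|w|%:R :> R by rewrite {1}wE -pmulrn.
  have g1 : `|w|%:R <= M%:R * z by rewrite -wR.
  have g2 : M%:R * z < `|w|.+1%:R by rewrite -natr1 -wR; move: f2; rewrite intrD.
  exists (false, Ordinal jM); rewrite ?ger0_norm//=.
    by rewrite /cell1/= ler_pdivrMr// ltr_pdivlMr// ![z * _]mulrC g1.
  by rewrite ler_pdivrMr// mulrC.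
have jM : (`|w|.-1 < M.+1)%N by lia.
have wE : w = - (`|w|.-1.+1)%:Z by lia.
have z0 : z < 0.
  rewrite -(pmulr_rlt0 _ MR); apply: lt_le_trans f2 _.
  by rewrite -[0]/(0%:~R) ler_int; lia.
have wR : w%:~R = - `|w|.-1.+1%:R :> R by rewrite {1}wE intrN -pmulrn.
have g1 : - `|w|.-1.+1%:R <= M%:R * z by rewrite -wR.
have g2 : M%:R * z < - `|w|.-1%:R.
  by move: f2; rewrite intrD wR -natr1 opprD addrNK.
exists (true, Ordinal jM); rewrite ?ltr0_norm//=.
  rewrite /cell1/=; apply/andP; split.
    by rewrite lerNl ler_pdivlMr//; lra.
  by rewrite ltrNr ltr_pdivrMr//; lra.
by rewrite ler_pdivrMr//; lra.
Qed.

Lemma cell1_norm M (c : bool * nat) z : cell1 M c z -> `|z| <= c.2.+1%:R / M%:R.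
Proof.
case: c => s j; rewrite /cell1/=.
have p0 : 0 <= j%:R / M%:R :> R by rewrite divr_ge0.
rewrite ler_norml; case: s => /andP[h1 h2]; apply/andP; split; lra.
Qed.

Definition cells (M : nat) := {ffun 'I_k -> bool * 'I_M.+1}.

Definition incell (M : nat) (c : cells M) (y : 'I_k -> R) : bool :=
  [forall i, cell1 M ((c i).1, nat_of_ord (c i).2) (y i)].

(** Cells whose corner nearest to 0 lies in the unit ball. *)
Definition outer (M : nat) : pred (cells M) :=
  fun c => (\sum_(i < k) (c i).2 ^ 2 <= M ^ 2)%N.

(** Cells whose corner farthest from 0 lies in the unit ball. *)
Definition inner (M : nat) : pred (cells M) :=
  fun c => (\sum_(i < k) (c i).2.+1 ^ 2 <= M ^ 2)%N.

Lemma enorm_le1 (y : 'I_k -> R) : (enorm y <= 1) = (\sum_(i < k) y i ^+ 2 <= 1).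
Proof. by rewrite /enorm -[X in _ <= X]sqrtr1 ler_sqrt. Qed.

Definition inball (y : 'I_k -> R) : bool := enorm y <= 1.

Lemma ball_outer M (y : 'I_k -> R) : (0 < M)%N ->
  (inball y)%:R <= \sum_(c | outer c) (@incell M c y)%:R :> R.
Proof.
move=> M0; have MR : 0 < M%:R :> R by rewrite ltr0n.
have [y1|_] := boolP (inball y); last exact: sumr_ge0.
have h i : exists c : bool * 'I_M.+1, cell1 M (c.1, nat_of_ord c.2) (y i) /\
    (c.2 : nat)%:R / M%:R <= `|y i|.
  have [c h1 h2] := cell1_ex M0 (le_trans (coord_le_enorm y i) y1).
  by exists c.
have [c hc] := choice h.
rewrite (bigD1 (finfun c))/=; last first.
  rewrite /outer -(ler_nat R) natr_sum; move: y1; rewrite /inball enorm_le1 => y1.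
  rewrite natrX -[leRHS]mulr1; apply: le_trans (ler_wpM2l _ y1); last first.
    by rewrite exprn_ge0.
  rewrite mulr_sumr; apply: ler_sum => i _; rewrite ffunE natrX.
  have [_ hi] := hc i; rewrite -[y i ^+ 2]real_normK ?num_real// -exprMn.
  by rewrite lerXn2r ?nnegrE ?mulr_ge0// mulrC -ler_pdivrMr.
rewrite (_ : incell _ _ = true) ?lerDl ?sumr_ge0//.
by apply/forallP => i; rewrite ffunE; have [] := hc i.
Qed.

Lemma inner_ball M (y : 'I_k -> R) : (0 < M)%N ->
  \sum_(c | inner c) (@incell M c y)%:R <= (inball y)%:R :> R.
Proof.
move=> M0; have MR : 0 < M%:R :> R by rewrite ltr0n.
have [[c /andP[ci cy]]|h] := pselect (exists c, inner c && @incell M c y); last first.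
  rewrite big1// => c ic; case: (boolP (incell c y)) => // cy.
  by exfalso; apply: h; exists c; rewrite ic.
have -> : inball y.
  rewrite /inball enorm_le1.
  apply: (@le_trans _ _ (\sum_(i < k) ((c i).2.+1%:R / M%:R) ^+ 2)).
    apply: ler_sum => i _; rewrite -[y i ^+ 2]real_normK ?num_real//.
    rewrite lerXn2r ?nnegrE ?divr_ge0//.
    by move/forallP : cy => /(_ i) /cell1_norm.
  under eq_bigr do rewrite expr_div_n.
  rewrite -mulr_suml ler_pdivrMr ?exprn_gt0// mul1r -natrX.
  by under eq_bigr do rewrite -natrX; rewrite -natr_sum ler_nat.
rewrite (bigD1 c)//= cy big1 ?addr0// => c' /andP[_ c'c].
case: (boolP (incell c' y)) => // c'y; exfalso; move/eqP : c'c; apply.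
apply/ffunP => i; move/forallP : cy => /(_ i) h; move/forallP : c'y => /(_ i) h'.
have := cell1_inj M0 h h'; case: (c i) (c' i) => [s j] [s' j'] /= [-> jj].
by congr pair; exact/val_inj.
Qed.

(** Shifting an outer cell one step towards 0 in every coordinate gives an inner
cell, unless the cell touches a coordinate hyperplane.  So the difference is at
most the number of cells which touch a coordinate hyperplane. *)
Lemma outer_inner_card M : (0 < M)%N ->
  (#|@outer M| <= #|@inner M| + ((2 * M.+1) ^ k - (2 * M) ^ k))%N.
Proof.
move=> M0; pose pos (c : cells M) := [forall i, 0 < (c i).2]%N.
have -> : #|@outer M| = (#|[predI @outer M & pos]| + #|[predD @outer M & pos]|)%N.
  by rewrite (cardID pos).
apply: leq_add.
  (* f moves a cell one step towards 0 in every coordinate *)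
  pose f (c : cells M) : cells M := [ffun i => ((c i).1, inord (c i).2.-1)].
  have jE (c : cells M) i : pos c -> (inord (c i).2.-1 : 'I_M.+1).+1 = (c i).2.
    move=> /forallP /(_ i) ci; rewrite inordK ?prednK//.
    by have := ltn_ord (c i).2; lia.
  rewrite -(@card_in_image _ _ f); last first.
    move=> c c'; rewrite !inE => /andP[_ pc] /andP[_ pc'] /ffunP ff.
    apply/ffunP => i; have := ff i; rewrite !ffunE => -[e1 e2].
    apply/eqP; rewrite -pair_eqE/= e1 eqxx/=; apply/eqP/val_inj => /=.
    by rewrite -(jE c i pc) -(jE c' i pc') e2.
  apply: subset_leq_card; apply/fintype.subsetP => _ /fintype.imageP[c + ->].
  rewrite !inE => /andP[oc pc]; rewrite /in_mem/= /inner.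
  move: oc; rewrite /in_mem/= /outer; congr (_ <= _)%N.
  by apply: eq_bigr => i _; rewrite ffunE/= jE.
have cardpos : #|pos| = ((2 * M) ^ k)%N.
  pose g (c : {ffun 'I_k -> bool * 'I_M}) : cells M :=
    [ffun i => ((c i).1, lift ord0 (c i).2)].
  have gi : injective g.
    move=> c c' /ffunP gg; apply/ffunP => i; have := gg i; rewrite !ffunE => -[e1 e2].
    apply/eqP; rewrite -pair_eqE/= e1 eqxx/=; apply/eqP. exact: val_inj.
  rewrite -[in RHS](card_ord M) -card_bool -card_prod -[k in RHS]card_ord -card_ffun.
  rewrite -(card_imset _ gi) cardE; rewrite -cardE.
  apply: eq_card => c; rewrite /in_mem/=; apply/idP/idP.
    move=> /forallP pc; apply/imsetP.
    exists [ffun i => ((c i).1, odflt (Ordinal M0) (unlift ord0 (c i).2))] => //.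
    apply/ffunP => i; rewrite !ffunE/=.
    have := pc i; case: (c i) => s j /=.
    by case: unliftP => [j' ->|->].
  by move=> /imsetP[c' _ ->]; apply/forallP => i; rewrite ffunE.
apply: (@leq_trans #|[predC pos]|).
  by apply: subset_leq_card; apply/fintype.subsetP => c; rewrite !inE => /andP[].
rewrite -cardpos leq_subRL; last first.
  rewrite cardpos leq_exp2r// leq_mul2l leqnSn orbT//.
rewrite cardC card_ffun card_prod card_bool !card_ord//.
Qed.

End ball.

(** * From boxes to cells and from cells to the ball *)

Lemma forallb_prod (R : comNzRingType) (I : finType) (P : pred I) :
  ([forall i, P i])%:R = \prod_i (P i)%:R :> R.
Proof.
case: forallP => [h|/forallP]; first by rewrite big1// => i _; rewrite h.
by rewrite negb_forall => /existsP[i /negbTE hi]; rewrite (bigD1 i)//= hi mul0r.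
Qed.

Lemma ae_forall_countable d (T : measurableType d) (R : realType)
    (mu : {measure set T -> \bar R}) (I : countType) (P : I -> T -> Prop) :
  (forall i, {ae mu, forall x, P i x}) -> {ae mu, forall x, forall i, P i x}.
Proof.
move=> h.
have : {ae mu, forall x, forall n : nat,
    if choice.unpickle n is Some i then P i x else True}.
  apply/ae_foralln => n; case: choice.unpickle => [i|]; first exact: h.
  exact: aeW.
by apply: filterS => x hx i; have := hx (choice.pickle i); rewrite choice.pickleK.
Qed.

Lemma integral_value_le d (T : measurableType d) (R : realType)
    (mu : {measure set T -> \bar R}) (D : set T) (f g : T -> R) (m n : R) :
  measurable D -> integral_value mu D f m -> integral_value mu D g n ->
  (forall x, D x -> f x <= g x) -> m <= n.
Proof.
move=> mD [mf f0 fm] [mg g0 gn] fg; rewrite -lee_fin -fm -gn.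
apply: ge0_le_integral => //; try exact/measurable_EFinP.
Qed.

Lemma cvg_sumr (R : realType) (I : Type) (s : seq I) (P : pred I)
    (u : I -> nat -> R) (l : I -> R) :
  (forall i, P i -> u i N @[N --> \oo] --> l i) ->
  \sum_(i <- s | P i) u i N @[N --> \oo] --> (\sum_(i <- s | P i) l i : R).
Proof. by move=> h; apply: cvg_big => //; exact: add_continuous. Qed.

Section hit_count.
Variables (R : realType) (k : nat).
Hypothesis k0 : (0 < k)%N.
Local Notation T := (k.-tuple (measurableTypeR R)).
Local Notation mu := (lebesgue_Rn R k).
Local Notation H := (harmonic_sum R).

Definition defect (L n : nat) (x : T) (p : numers k L n) (i : 'I_k) : R :=
  (n%:R * (tnth x i : R) - (numer L n (p i))%:~R) / tolerance R k n.

Definition hit_count (L : nat) (P : ('I_k -> R) -> bool) (N : nat) (x : T) : R :=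
  \sum_(1 <= n < N) \sum_(p : numers k L n) (P (defect x p))%:R.

Definition inbox (a b y : 'I_k -> R) : bool := [forall i, a i <= y i < b i].

Lemma hits_hit_count L a b N x : hits a b L N x = hit_count L (inbox a b) N x.
Proof.
rewrite /hits /hit_count big_nat [RHS]big_nat; apply: eq_bigr => n /andP[n0 _].
apply: eq_bigr => p _; rewrite indicE; congr (_%:R); congr nat_of_bool.
have nR : 0 < n%:R :> R by rewrite ltr0n.
have r0 := tolerance_gt0 R k n0.
have E i : (a i <= defect x p i < b i) = ((tnth x i : R) \in
    `[endpoint L n (p i) (a i) (tolerance R k n), endpoint L n (p i) (b i) (tolerance R k n)[).
  rewrite in_itv/= /defect /endpoint ler_pdivlMr// ltr_pdivrMr//.
  rewrite (ler_pdivrMr _ _ nR) (ltr_pdivlMr _ _ nR).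
  by rewrite lerBrDl ltrBlDl ![n%:R * _]mulrC.
apply/idP/forallP => [|h].
  by move=> /set_mem h i; rewrite E; exact: (h i).
by apply/mem_set => i /=; rewrite -E; exact: h.
Qed.

Lemma hit_count_linear (I : Type) (s : seq I) (c : I -> R)
    (P : I -> ('I_k -> R) -> bool) L (Q : ('I_k -> R) -> bool) N x :
  (forall y, (Q y)%:R = \sum_(i <- s) c i * (P i y)%:R) ->
  hit_count L Q N x = \sum_(i <- s) c i * hit_count L (P i) N x.
Proof.
move=> QE; rewrite /hit_count; under [RHS]eq_bigr do rewrite mulr_sumr.
rewrite [RHS]exchange_big/=; apply: eq_bigr => n _.
under [RHS]eq_bigr do rewrite mulr_sumr.
by rewrite [RHS]exchange_big/=; apply: eq_bigr => p _.
Qed.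

Definition seg_lo (s : 'I_k -> bool) (t : 'I_k -> R) i : R := if s i then - t i else 0.
Definition seg_up (s : 'I_k -> bool) (t : 'I_k -> R) i : R := if s i then 0 else t i.

Lemma inbox_half_segment s t y :
  inbox (seg_lo s t) (seg_up s t) y = [forall i, half_segment (s i) (t i) (y i)].
Proof. by apply: eq_forallb => i; rewrite /seg_lo /seg_up /half_segment; case: (s i). Qed.

Lemma vol_half_segment s t : vol (seg_lo s t) (seg_up s t) = \prod_i t i.
Proof.
apply: eq_bigr => i _; rewrite /seg_lo /seg_up.
by case: (s i); rewrite ?sub0r ?opprK ?subr0.
Qed.

(** The corners of a cell are indexed by the set E of coordinates in which the end
farther from 0 is taken. *)
Definition corner M (c : cells k M) (E : {set 'I_k}) (i : 'I_k) : nat :=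
  if i \in E then ((c i).2).+1 else (c i).2.

Definition corner_sign (E : {set 'I_k}) : R := \prod_(i < k) (if i \in E then 1 else -1).

(** In each coordinate the indicator of a cell is a difference of indicators of two
half segments; expanding the product gives inclusion-exclusion over the corners. *)
Lemma incell_corners M (c : cells k M) (y : 'I_k -> R) : (0 < M)%N ->
  (incell c y)%:R = \sum_(E : {set 'I_k}) corner_sign E *
    (inbox (seg_lo (fun i => (c i).1) (fun i => (corner c E i)%:R / M%:R))
           (seg_up (fun i => (c i).1) (fun i => (corner c E i)%:R / M%:R)) y)%:R.
Proof.
move=> M0; rewrite /incell forallb_prod.
under eq_bigr do rewrite cell1E//.
rewrite bigA_distr; apply: eq_bigr => E _.
rewrite inbox_half_segment forallb_prod /corner_sign -big_split/=.
by apply: eq_bigr => i _; rewrite /corner; case: ifP; rewrite ?mul1r ?mulN1r.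
Qed.

Lemma corners_vol M (c : cells k M) : (0 < M)%N ->
  \sum_(E : {set 'I_k}) corner_sign E * \prod_i ((corner c E i)%:R / M%:R) =
  M%:R ^- k.
Proof.
move=> M0; have MR : M%:R != 0 :> R by rewrite pnatr_eq0 -lt0n.
rewrite -exprVn -[k in RHS]card_ord -prodr_const.
rewrite (eq_bigr (fun i => ((c i).2).+1%:R / M%:R + - ((c i).2%:R / M%:R))); last first.
  by move=> i _; rewrite -natr1; field.
rewrite bigA_distr; apply: eq_bigr => E _.
rewrite /corner_sign -big_split/=.
by apply: eq_bigr => i _; rewrite /corner; case: ifP; rewrite ?mul1r ?mulN1r.
Qed.

(** All half segments in use have rational ends, so that countably many null sets
are discarded. *)
Lemma ae_cells_cvg : {ae mu, forall x : T, forall (L M : nat) (c : cells k M),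
  (0 < L)%N -> (0 < M)%N -> cube L x ->
  hit_count L (@incell R k M c) N x / H N @[N --> \oo] --> (M%:R ^- k : R)}.
Proof.
pose P (u : nat * nat * {ffun 'I_k -> bool} * {ffun 'I_k -> nat}) (x : T) :=
  let: (L, M, s, t) := u in
  let t' := fun i => (t i)%:R / M%:R : R in
  (0 < L)%N -> (forall i, t i <= 2 * M)%N -> (0 < M)%N -> cube L x ->
  hit_count L (inbox (seg_lo s t') (seg_up s t')) N x / H N @[N --> \oo]
     --> (\prod_i t' i : R).
have : {ae mu, forall x, forall u, P u x}.
  apply: ae_forall_countable => -[[[L M] s] t] /=.
  have [L0|L0] := pselect (0 < L)%N; last by apply: aeW => x /= /L0.
  have [tM|tM] := pselect (forall i, t i <= 2 * M)%N; last by apply: aeW => x /= _ /tM.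
  have [M0|M0] := pselect (0 < M)%N; last by apply: aeW => x /= _ _ /M0.
  pose t' (i : 'I_k) : R := (t i)%:R / M%:R.
  have t'0 i : 0 <= t' i by rewrite divr_ge0.
  have t'2 i : t' i <= 2.
    by rewrite /t' ler_pdivrMr ?ltr0n// -natrM ler_nat tM.
  have lo i : -2 <= seg_lo s t' i <= 0.
    by rewrite /seg_lo; have := t'0 i; have := t'2 i; case: (s i) => ? ?;
      apply/andP; split; lra.
  have up i : 0 <= seg_up s t' i <= 2.
    by rewrite /seg_up; have := t'0 i; have := t'2 i; case: (s i) => ? ?;
      apply/andP; split; lra.
  apply: filterS (ae_hits_cvg k0 lo up L0) => x hx t1 _ _ _ Qx; rewrite /t1 {t1}.
  have -> : \prod_(i < k) ((t i)%:R / M%:R) = vol (seg_lo s t') (seg_up s t').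
    by rewrite vol_half_segment.
  under eq_fun do rewrite -hits_hit_count.
  exact: hx.
apply: filterS => x hx L M c L0 M0 Qx.
rewrite -(corners_vol c M0).
under eq_fun => N do rewrite (hit_count_linear _ _ _ (fun y => incell_corners c y M0)) mulr_suml.
apply: cvg_sumr => E _.
under eq_fun do rewrite -mulrA.
apply: cvgM; first exact: cvg_cst.
have := hx (L, M, [ffun i => (c i).1], [ffun i => corner c E i]) L0 _ M0 Qx.
rewrite (_ : (fun i => ([ffun i0 => corner c E i0] i)%:R / M%:R) =
  (fun i => (corner c E i)%:R / M%:R :> R)); last by apply/funext => i; rewrite ffunE.
rewrite (_ : seg_lo [ffun i => (c i).1] = seg_lo (fun i => (c i).1)); last first.
  by apply/funext => t; apply/funext => i; rewrite /seg_lo ffunE.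
rewrite (_ : seg_up [ffun i => (c i).1] = seg_up (fun i => (c i).1)); last first.
  by apply/funext => t; apply/funext => i; rewrite /seg_up ffunE.
have -> : \prod_i (([ffun i0 => corner c E i0] i)%:R / M%:R) =
    \prod_i ((corner c E i)%:R / M%:R) :> R.
  by apply: eq_bigr => i _; rewrite ffunE.
by apply=> i; rewrite ffunE /corner; have := ltn_ord (c i).2; case: ifP => _; lia.
Qed.

Lemma integral_value_cell M (c : cells k M) : (0 < M)%N ->
  integral_value mu setT (fun x : T => (incell c (tnth x))%:R) (M%:R ^- k).
Proof.
move=> M0; have MR : 0 < M%:R :> R by rewrite ltr0n.
pose I i : interval R := if (c i).1 then
    `[- ((c i).2.+1%:R / M%:R), - ((c i).2%:R / M%:R)[
  else `[(c i).2%:R / M%:R, (c i).2.+1%:R / M%:R[.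
have IE i z : cell1 M ((c i).1, nat_of_ord (c i).2) z = (z \in I i).
  by rewrite /cell1 /I /=; case: (c i).1; rewrite in_itv.
have mI i : measurable ([set` I i] : set (measurableTypeR R)) by exact: measurable_itv.
pose A : set T := [set x | forall i, [set` I i] (tnth x i)].
have mA : measurable A by exact: (@measurable_rect R k (fun i => [set` I i])).
rewrite (_ : (fun x : T => _) = \1_A); last first.
  apply/funext => x; rewrite indicE; congr (_%:R); congr nat_of_bool.
  apply/forallP/idP => [h|/set_mem h i]; last by rewrite IE; exact: (h i).
  by apply/mem_set => i /=; rewrite -IE; exact: h.
apply: integral_value_indic => //.
rewrite [LHS](power_measure_rect _ mI) (eq_bigr (fun=> (M%:R^-1 : R)%:E)).
  by rewrite prodEFin prodr_const card_ord exprVn.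
move=> i _; rewrite [LHS]lebesgue_measure_itv /I.
have lt : (c i).2%:R / M%:R < (c i).2.+1%:R / M%:R :> R.
  by rewrite ltr_pM2r ?invr_gt0// ltr_nat.
have E : (c i).2.+1%:R / M%:R - (c i).2%:R / M%:R = M%:R^-1 :> R.
  by rewrite -natr1; field; rewrite gt_eqF.
case: (c i).1 => /=; rewrite lte_fin ?ltrN2 lt -?EFinN -EFinD; congr EFin; lra.
Qed.

Lemma integral_value_ball :
  integral_value mu setT (fun x : T => (inball (tnth x))%:R) (ball_volume R k).
Proof.
rewrite (_ : (fun x : T => _) = \1_(unit_ball R k)); last first.
  apply/funext => x; rewrite indicE; congr (_%:R); congr nat_of_bool.
  by apply/idP/idP => [h|/set_mem//]; apply/mem_set.
apply: integral_value_indic => //; first exact: measurable_unit_ball.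
by rewrite fineK// lebesgue_unit_ball_fin_num.
Qed.

(** Integrating the pointwise bounds inner_ball and ball_outer: each cell has
measure M^(-k). *)
Lemma ball_volume_bounds M : (0 < M)%N ->
  #|@inner k M|%:R * M%:R ^- k <= ball_volume R k <= #|@outer k M|%:R * M%:R ^- k.
Proof.
move=> M0.
have sumE (P : pred (cells k M)) : integral_value mu setT
    (fun x : T => \sum_(c | P c) (incell c (tnth x))%:R) (#|P|%:R * M%:R ^- k).
  have -> : #|P|%:R * M%:R ^- k = \sum_(c <- [seq c <- index_enum _ | P c]) M%:R ^- k :> R.
    by rewrite big_filter sumr_const mulr_natl.
  under [X in integral_value _ _ X _]eq_fun do rewrite -big_filter.
  by apply: integral_value_sum => // c; exact: integral_value_cell.
apply/andP; split.
  apply: integral_value_le (sumE _) integral_value_ball _ => // x _.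
  exact: inner_ball.
apply: integral_value_le integral_value_ball (sumE _) _ => // x _.
exact: ball_outer.
Qed.

(** A bound for the total measure of the outer cells which are not inner cells. *)
Definition cell_gap (M : nat) : R := ((2 * M.+1) ^ k - (2 * M) ^ k)%:R * M%:R ^- k.

Lemma cell_gap_cvg0 : cell_gap M @[M --> \oo] --> (0 : R).
Proof.
rewrite -(@cvg_shiftn 1).
rewrite (_ : (fun M => _) = (fun M : nat => 2 ^+ k * ((1 + harmonic M) ^+ k - 1))); last first.
  apply/funext => M; rewrite addn1 /cell_gap /harmonic/=.
  have MR : 0 < M.+1%:R :> R by rewrite ltr0n.
  rewrite natrB; last by rewrite leq_exp2r// leq_mul2l leqnSn orbT.
  rewrite !natrX !natrM !exprMn -mulrBr -mulrA; congr (_ * _).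
  rewrite mulrBl -expr_div_n divff ?expf_neq0 ?gt_eqF//.
  by congr (_ ^+ _ - _); rewrite -[M.+2%:R]natr1; field; rewrite gt_eqF.
have h0 := @cvg_harmonic R.
have h1 : 1 + harmonic M @[M --> \oo] --> (1 : R).
  rewrite -[X in _ --> X]addr0; apply: cvgD => //; exact: cvg_cst.
have hX j : (1 + harmonic M) ^+ j @[M --> \oo] --> (1 : R).
  elim: j => [|j IH]; first by under eq_fun do rewrite expr0; exact: cvg_cst.
  under eq_fun do rewrite exprS.
  have h := cvgM h1 IH; rewrite mulr1 in h; exact: h.
have h2 (t : R) : (fun=> t) @ \oo --> t by exact: cvg_cst.
have h := cvgM (h2 (2 ^+ k)) (cvgB (hX k) (h2 1)).
by rewrite subrr mulr0 in h; exact: h.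
Qed.

Lemma ae_ball_cvg : {ae mu, forall x : T, forall L : nat, (0 < L)%N ->
  cube L x -> hit_count L (@inball R k) N x / H N @[N --> \oo] --> ball_volume R k}.
Proof.
apply: filterS ae_cells_cvg => x hx L L0 Qx.
apply/cvgrPdist_lt => e e0.
have e2 : 0 < e / 2 by rewrite divr_gt0.
have [M0 _ HM] := (cvgr0Pnorm_lt _).1 cell_gap_cvg0 _ e2.
pose M := M0.+1; have Mp : (0 < M)%N by [].
have gapM : cell_gap M < e / 2.
  by apply: le_lt_trans (ler_norm _) _; apply: HM => /=.
have sumcvg (P : pred (cells k M)) :
    \sum_(c | P c) hit_count L (@incell R k M c) N x / H N @[N --> \oo] -->
      (#|P|%:R * M%:R ^- k : R).
  rewrite mulr_natl -sumr_const; apply: cvg_sumr => c _; exact: hx.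
have /andP[vi vo] := ball_volume_bounds Mp.
have gap : #|@outer k M|%:R * M%:R ^- k <= #|@inner k M|%:R * M%:R ^- k + cell_gap M :> R.
  rewrite /cell_gap -mulrDl ler_wpM2r ?invr_ge0 ?exprn_ge0//.
  by rewrite -natrD ler_nat outer_inner_card.
have [N1 _ H1] := (cvgrPdist_lt _ _).1 (sumcvg (@inner k M)) _ e2.
have [N2 _ H2] := (cvgrPdist_lt _ _).1 (sumcvg (@outer k M)) _ e2.
exists (maxn N1 N2) => // N /= hN.
have := H1 N (leq_trans (leq_maxl _ _) hN); have := H2 N (leq_trans (leq_maxr _ _) hN).
rewrite /= !ltr_norml => /andP[u1 u2] /andP[l1 l2].
have lo : \sum_(c | @inner k M c) hit_count L (@incell R k M c) N x / H N <=
    hit_count L (@inball R k) N x / H N.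
  rewrite -mulr_suml ler_wpM2r ?invr_ge0 ?harmonic_sum_ge0//.
  rewrite /hit_count exchange_big/=; apply: ler_sum => n _.
  rewrite exchange_big/=; apply: ler_sum => p _; exact: inner_ball.
have up : hit_count L (@inball R k) N x / H N <=
    \sum_(c | @outer k M c) hit_count L (@incell R k M c) N x / H N.
  rewrite -mulr_suml ler_wpM2r ?invr_ge0 ?harmonic_sum_ge0//.
  rewrite /hit_count [leRHS]exchange_big/=; apply: ler_sum => n _.
  rewrite [leRHS]exchange_big/=; apply: ler_sum => p _; exact: ball_outer.
apply/andP; split; lra.
Qed.

End hit_count.

(** * Counting all solutions *)

Section counting.
Variables (R : realType) (k : nat).
Hypothesis k0 : (0 < k)%N.
Local Notation T := (k.-tuple (measurableTypeR R)).
Local Notation H := (harmonic_sum R).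

Definition nat_above (t : R) : nat := `|Num.ceil t|%N.

Lemma lt_nat_above (t : R) (n : nat) : 0 <= t -> (n < nat_above t)%N = (n%:R < t).
Proof.
move=> t0; have c0 : 0 <= Num.ceil t by rewrite ceil_ge0; exact: lt_le_trans t0.
by rewrite [n%:R]pmulrn -ceil_gt_int -[in RHS](gez0_abs c0) ltz_nat.
Qed.

Lemma enorm_scale (c : R) (v : 'I_k -> R) : 0 <= c ->
  enorm (fun i => c * v i) = c * enorm v.
Proof.
move=> c0; rewrite /enorm; under eq_bigr do rewrite exprMn.
by rewrite -mulr_sumr sqrtrM ?sqr_ge0// sqrtr_sqr ger0_norm.
Qed.

Lemma enormN (v : 'I_k -> R) : enorm (fun i => - v i) = enorm v.
Proof. by rewrite /enorm; under eq_bigr do rewrite sqrrN. Qed.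

Lemma inball_defect L n (x : T) (p : numers k L n) : (0 < n)%N ->
  inball (defect x p) =
  (enorm (fun i => n%:R * (tnth x i : R) - (numer L n (p i))%:~R) <= tolerance R k n).
Proof.
move=> n0; have r0 := tolerance_gt0 R k n0.
rewrite /inball /defect (_ : enorm _ = (tolerance R k n)^-1 *
    enorm (fun i => n%:R * (tnth x i : R) - (numer L n (p i))%:~R)).
  by rewrite mulrC ler_pdivrMr// mul1r.
rewrite -enorm_scale ?invr_ge0 ?(ltW r0)//.
by congr enorm; apply/funext => i; rewrite mulrC.
Qed.

Definition numer_tuple L n (p : numers k L n) : k.-tuple int := [tuple numer L n (p i) | i < k].

Definition close_pts L (x : T) (n : nat) : seq (numers k L n) :=
  [seq p <- enum {: numers k L n} | inball (defect x p)].

Definition pos_seq L (x : T) (N : nat) : seq (int * k.-tuple int) :=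
  [seq (n%:Z, numer_tuple p) | n <- index_iota 1 N, p <- close_pts L x n].

Definition opp_pair (u : int * k.-tuple int) : int * k.-tuple int :=
  (- u.1, [tuple - tnth u.2 i | i < k]).

Lemma opp_pairK : involutive opp_pair.
Proof.
move=> [n p]; rewrite /opp_pair/= opprK; congr pair.
by apply: eq_from_tnth => i; rewrite !tnth_mktuple opprK.
Qed.

Lemma numer_tuple_inj L n : injective (@numer_tuple L n).
Proof.
move=> p q pq; apply/ffunP => i; apply: val_inj => /=.
have : tnth (numer_tuple p) i = tnth (numer_tuple q) i by rewrite pq.
by rewrite !tnth_mktuple /numer; lia.
Qed.

Lemma pos_seq_uniq L x N : uniq (pos_seq L x N).
Proof.
apply: allpairs_uniq_dep; first exact: iota_uniq.
  by move=> n _; rewrite filter_uniq// enum_uniq.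
move=> [n p] [m q] _ _ /= e; have [nm] := congr1 fst e.
by subst m; have /= /numer_tuple_inj -> := congr1 snd e.
Qed.

Lemma size_pos_seq L x N : (size (pos_seq L x N))%:R = hit_count L (@inball R k) N x.
Proof.
rewrite size_allpairs_dep sumnE big_map natr_sum; apply: eq_bigr => n _.
rewrite /close_pts size_filter -sum1_count natr_sum big_enum_cond/= big_mkcond/=.
by apply: eq_bigr => p _; case: inball.
Qed.

Lemma approximations_opp (x : T) (t : R) u :
  approximations x t u -> approximations x t (opp_pair u).
Proof.
case: u => n p [/= n1 nt np]; split => /=; rewrite ?normrN//.
apply: le_trans np; rewrite -[leRHS]enormN le_eqVlt; apply/orP; left; apply/eqP.
congr enorm; apply/funext => i.
by rewrite tnth_mktuple !intrN; ring.
Qed.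

Lemma pos_seq_approximation L x (t : R) u : 0 <= t ->
  u \in pos_seq L x (nat_above t) -> approximations x t u /\ 0 < u.1.
Proof.
move=> t0 /allpairsPdep[n [p [nN pc ->]]]/=.
move: nN; rewrite mem_index_iota lt_nat_above// => /andP[n0 nt].
move: pc; rewrite mem_filter inball_defect// => /andP[pc _].
split => //; split => /=.
- by lia.
- by rewrite -pmulrn.
rewrite -pmulrn !div1r -/(tolerance R k n).
apply: le_trans pc; rewrite le_eqVlt; apply/orP; left; apply/eqP.
by congr enorm; apply/funext => i; rewrite tnth_mktuple.
Qed.

(** A solution has |p_i| <= n (L - 1) + 1, which is at most L n - 3 for n >= 4, so its
numerators are in the range of numer. *)
Lemma approximation_pos_seq L x (t : R) (n : nat) q : 0 <= t ->
  (forall i, `|tnth x i : R| <= L%:R - 1) -> (4 <= n)%N ->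
  approximations x t (n%:Z, q) -> (n%:Z, q) \in pos_seq L x (nat_above t).
Proof.
move=> t0 xL n4 [/= n1 nt nq].
have n0 : (0 < n)%N by lia.
have nR : 0 < n%:R :> R by rewrite ltr0n.
have nr : enorm (fun i => n%:R * (tnth x i : R) - (tnth q i)%:~R) <= tolerance R k n.
  by move: nq; rewrite -!pmulrn !div1r.
have L1 : 1 <= L%:R :> R.
  by rewrite -subr_ge0; apply: le_trans (xL (Ordinal k0)).
have Ln : (3 <= L * n)%N.
  rewrite ler1n in L1; apply: (@leq_trans n); [exact: ltnW|exact: leq_pmull].
have qb i : `|tnth q i| <= (L * n - 3)%:Z.
  have h1 : `|n%:R * (tnth x i : R) - (tnth q i)%:~R| <= 1.
    apply: le_trans (coord_le_enorm
      (fun i => n%:R * (tnth x i : R) - (tnth q i)%:~R) i) _.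
    exact: le_trans nr (tolerance_le1 _ _ n0).
  have h2 : `|n%:R * (tnth x i : R)| <= n%:R * (L%:R - 1).
    by rewrite normrM ger0_norm ?ler_pM2l ?xL// ltW.
  have h3 : `|(tnth q i)%:~R| <= (L * n)%:R - 3 :> R.
    have -> : (tnth q i)%:~R = n%:R * (tnth x i : R) -
      (n%:R * (tnth x i : R) - (tnth q i)%:~R) by rewrite subKr.
    apply: le_trans (ler_normB _ _) _; apply: le_trans (lerD h2 h1) _.
    have : 4 <= n%:R :> R by rewrite ler_nat.
    rewrite natrM; lra.
  by rewrite -(ler_int R) intr_norm -pmulrn natrB.
have hb i : (`|(tnth q i + (L * n - 2)%:Z)%R|%N < 2 * (L * n - 2))%N.
  by have := qb i; lia.
pose p : numers k L n := [ffun i => Ordinal (hb i)].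
have pq : numer_tuple p = q.
  apply: eq_from_tnth => i; rewrite tnth_mktuple /numer ffunE/=.
  by have := qb i; lia.
have px : inball (defect x p).
  rewrite inball_defect//; apply: le_trans nr; rewrite le_eqVlt; apply/orP; left.
  by apply/eqP; congr enorm; apply/funext => i; rewrite -[in RHS]pq tnth_mktuple.
apply/allpairsPdep; exists n, p; split.
- by rewrite mem_index_iota n0/= lt_nat_above// pmulrn.
- by rewrite mem_filter px mem_enum.
- by rewrite pq.
Qed.

(** Opposite solutions account for the factor 2, and solutions with |n| < 4 for the
additional term. *)
Lemma nb_approximations_bounds L x (t : R) : 0 <= t ->
  (forall i, `|tnth x i : R| <= L%:R - 1) ->
  2 * hit_count L (@inball R k) (nat_above t) x <= (nb_approximations x t)%:R <=
  2 * hit_count L (@inball R k) (nat_above t) x + (nb_approximations x 4)%:R.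
Proof.
move=> t0 xL; set s := pos_seq L x (nat_above t).
pose s2 := s ++ map opp_pair s.
have fin t' := finite_approximations x t'.
have s2E : 2 * hit_count L (@inball R k) (nat_above t) x = (size s2)%:R.
  by rewrite size_cat size_map natrD -!size_pos_seq mulr_natl mulr2n.
rewrite s2E -natrD !ler_nat; apply/andP; split.
  rewrite /nb_approximations; apply: uniq_leq_size.
    rewrite cat_uniq pos_seq_uniq map_inj_uniq ?pos_seq_uniq ?andbT; last first.
      exact: inv_inj opp_pairK.
    rewrite -all_predC; apply/allP => _ /mapP[u us ->] /=.
    apply/negP => /(pos_seq_approximation t0)[_ /=].
    have [_ u0] := pos_seq_approximation t0 us.
    by rewrite oppr_gt0 => /(lt_trans u0); rewrite ltxx.
  move=> u; rewrite mem_cat => us; rewrite in_fset_set//; apply/mem_set.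
  case/orP: us => [us|/mapP[v vs ->]].
    by have [] := pos_seq_approximation t0 us.
  by apply: approximations_opp; have [] := pos_seq_approximation t0 vs.
rewrite -size_cat; apply: uniq_leq_size; first exact: fset_uniq.
move=> [n q]; rewrite in_fset_set// => /set_mem nq; rewrite mem_cat.
have [n4|n4] := leqP 4 `|n|%N; last first.
  apply/orP; right; rewrite in_fset_set//; apply/mem_set.
  case: nq => /= n1 _ nq; split => //=.
  by rewrite (_ : 4 = (4%:Z)%:~R)// ltr_int; lia.
apply/orP; left; rewrite mem_cat.
have [n0|n0] := leP 0 n.
  apply/orP; left; have nE : n = `|n|%N by lia.
  by rewrite nE; apply: approximation_pos_seq => //; rewrite -nE.
apply/orP; right; rewrite -[(n, q)]opp_pairK map_f//.
have := approximations_opp nq; rewrite /opp_pair/=.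
have nE : - n = `|n|%N by lia.
by rewrite nE => h; apply: approximation_pos_seq.
Qed.

(** In the grid of mesh 1 / k the cells at 0 are inner cells. *)
Lemma ball_volume_gt0 : 0 < ball_volume R k.
Proof.
have /andP[+ _] := ball_volume_bounds R k0 k0; apply: lt_le_trans.
rewrite divr_gt0 ?exprn_gt0 ?ltr0n//; apply/card_gt0P.
exists [ffun=> (false, ord0)]; rewrite /in_mem/= /inner.
under eq_bigr do rewrite ffunE/=.
by rewrite sum_nat_const card_ord muln1 -mulnn leq_pmulr.
Qed.

Lemma inv_ln_cvg0 : (ln t)^-1 @[t --> +oo] --> (0 : R).
Proof.
apply/cvgr0Pnorm_lt => e e0; near=> t.
have te : expR e^-1 < t by near: t; exact: nbhs_pinfty_gt.
have lt : e^-1 < ln t.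
  by rewrite -[ltLHS]expRK ltr_ln ?posrE ?expR_gt0//; exact: lt_trans te; exact: expR_gt0.
have l0 : 0 < ln t by apply: lt_trans lt; rewrite invr_gt0.
by rewrite ger0_norm ?invr_ge0 ?ltW// invf_plt ?posrE.
Unshelve. all: by end_near. Qed.

Lemma nat_above_cvg : nat_above t @[t --> +oo] --> \oo.
Proof.
apply/cvgnyPge => A; near=> t.
have tA : A%:R < t by near: t; exact: nbhs_pinfty_gt.
by apply/ltnW; rewrite lt_nat_above// ltW// (le_lt_trans _ tA).
Unshelve. all: by end_near. Qed.

Lemma harmonic_sum_above (t : R) : 1 < t -> ln t <= H (nat_above t) <= 1 + ln t.
Proof.
move=> t1; have t0 : 0 <= t by lra.
have N1 : (1 < nat_above t)%N by rewrite lt_nat_above.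
have tN : t <= (nat_above t)%:R by rewrite leNgt -lt_nat_above// ltnn.
apply/andP; split.
  apply: le_trans (ln_le_harmonic_sum R (ltnW N1)).
  by rewrite ler_ln ?posrE//; lra.
have -> : nat_above t = (nat_above t).-2.+2 by lia.
apply: le_trans (harmonic_sum_le_ln R _) _; rewrite lerD2l ler_ln ?posrE ?ltr0n//; last by lra.
by rewrite ltW// -lt_nat_above//; lia.
Qed.

Lemma nb_ratio_cvg L (x : T) :
  (forall i, `|tnth x i : R| <= L%:R - 1) ->
  hit_count L (@inball R k) N x / H N @[N --> \oo] --> ball_volume R k ->
  (nb_approximations x t)%:R / (2 * ball_volume R k * ln t) @[t --> +oo] --> (1 : R).
Proof.
move=> xL hx; set B := ball_volume R k.
have B0 : 0 < B := ball_volume_gt0.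
have il := inv_ln_cvg0.
have hN : hit_count L (@inball R k) (nat_above t) x / H (nat_above t) @[t --> +oo] --> B.
  exact: cvg_comp nat_above_cvg hx.
have cc (c : R) : (fun=> c) @ (pinfty_nbhs R) --> c by exact: cvg_cst.
have lnt : \forall t \near +oo, 1 < t :> R by exact: nbhs_pinfty_gt.
have HL : H (nat_above t) / ln t @[t --> +oo] --> (1 : R).
  apply: (@squeeze_cvgr _ _ _ _ (fun=> 1) (fun t => 1 + (ln t)^-1)).
  - apply: filterS lnt => t t1; have /andP[h1 h2] := harmonic_sum_above t1.
    have l0 : 0 < ln t by exact: ln_gt0.
    rewrite ler_pdivlMr// mul1r h1/= ler_pdivrMr// mulrDl mul1r mulVf ?gt_eqF//.
    by rewrite addrC.
  - exact: cc.
  - by have h := cvgD (cc 1) il; rewrite addr0 in h; exact: h.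
have main : (hit_count L (@inball R k) (nat_above t) x / H (nat_above t)) *
    (H (nat_above t) / ln t) / B @[t --> +oo] --> (1 : R).
  have h := cvgM (cvgM hN HL) (cc B^-1); rewrite mulr1 mulfV ?gt_eqF// in h.
  exact: h.
pose E : R := (nb_approximations x 4)%:R / (2 * B).
have err : (hit_count L (@inball R k) (nat_above t) x / H (nat_above t)) *
    (H (nat_above t) / ln t) / B + E * (ln t)^-1 @[t --> +oo] --> (1 : R).
  have h := cvgD main (cvgM (cc E) il); rewrite mulr0 addr0 in h; exact: h.
apply: squeeze_cvgr main err; apply: filterS lnt => t t1.
have l0 : 0 < ln t by exact: ln_gt0.
have h0 : 0 < H (nat_above t) by have /andP[+ _] := harmonic_sum_above t1; exact: lt_le_trans.
have t0 : 0 <= t by lra.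
have /andP[lo up] := nb_approximations_bounds t0 xL.
set S := hit_count _ _ _ _ in lo up *; set W := (nb_approximations x t)%:R in lo up *.
have D0 : 0 < 2 * B * ln t by rewrite !mulr_gt0.
have -> : S / H (nat_above t) * (H (nat_above t) / ln t) / B = 2 * S / (2 * B * ln t).
  by field; rewrite !gt_eqF.
rewrite /E (_ : _ + _ = (2 * S + (nb_approximations x 4)%:R) / (2 * B * ln t)).
  by rewrite !ler_pM2r ?invr_gt0// lo up.
by field; rewrite !gt_eqF.
Qed.

End counting.

Theorem theorem1p2 (R : realType) (k : nat) (hk : (1 <= k)%N) :
  {ae lebesgue_Rn R k, forall x : k.-tuple (measurableTypeR R),
    (nb_approximations x T)%:R / (2 * ball_volume R k * ln T)
      @[T --> +oo] --> (1 : R)}.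
Proof.
apply: filterS (ae_ball_cvg R hk) => x hx.
pose S : R := \sum_(i < k) `|tnth x i : R|.
pose L := (Num.truncn S).+2.
have xL i : `|tnth x i : R| <= L%:R - 1.
  apply: (@le_trans _ _ S); first by rewrite /S (bigD1 i)//= lerDl sumr_ge0.
  by rewrite /L -[_.+2%:R]natr1 addrK ltW// truncnS_gt.
apply: (nb_ratio_cvg hk xL); apply: hx => // i /=; rewrite in_itv/= -ler_norml.
by apply: le_trans (xL i) _; rewrite gerBl.
Qed.
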